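(* Let $d\ge 3$ and let $\varepsilon\ge 0$ be arbitrary. Assume that $\sup_{t}V''(t)\le 1$ and $\liminf_{|t|\uparrow\infty}\frac{\log V(t)}{\log|t|}>1$, and let the $\eta_i$ be symmetrically distributed, i.i.d. with finite second moment. Then there are positive constants $B_1,B_2<\infty$, independent of the distribution of the random fields and of the pinning strength $\varepsilon\ge 0$, such that $$\liminf_{L\uparrow\infty}\frac{1}{L^d}\sum_{i\in\Lambda_L}\mathbb{E}\Bigl(\eta_i\,\mu_{\varepsilon,\Lambda_L}[\eta](\phi_i)\Bigr)\ \ge\ \frac{\mathbb{E}(\eta_0^2)\,(-\Delta^{-1})_{0,0}}{2}-\log(B_1+B_2\varepsilon),$$ where the positive constant $(-\Delta^{-1})_{0,0}$ is the diagonal element of the inverse of the infinite-volume lattice Laplace operator, whose existence is guaranteed in $d\ge 3$.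
   Context: $V:\mathbb{R}\to\mathbb{R}$ is a pair potential. For a finite set $\Lambda\subset\mathbb{Z}^d$, $\varepsilon\ge 0$, and a fixed configuration $\eta=(\eta_i)_{i\in\mathbb{Z}^d}$ of real external fields, $\mu_{\varepsilon,\Lambda}[\eta]$ is the quenched finite-volume Gibbs measure with zero boundary condition, i.e. the probability measure for the variables $\phi_\Lambda=(\phi_i)_{i\in\Lambda}\in\mathbb{R}^\Lambda$ given by $$\mu_{\varepsilon,\Lambda}[\eta](d\phi_\Lambda)=\frac{1}{Z_{\varepsilon,\Lambda}[\eta]}\exp\Bigl(-\frac1{4d}\sum_{\langle i,j\rangle\in\Lambda}V(\phi_i-\phi_j)-\frac1{4d}\sum_{i\in\Lambda,\,j\in\Lambda^c,\,|i-j|=1}V(\phi_i)+\sum_{i\in\Lambda}\eta_i\phi_i\Bigr)\prod_{i\in\Lambda}\bigl(d\phi_i+\varepsilon\,\delta_0(d\phi_i)\bigr),$$ where the first sum runs over nearest-neighbor pairs in $\Lambda$, $\Lambda^c=\mathbb{Z}^d\setminus\Lambda$, $d\phi_i$ is Lebesgue measure, $\delta_0$ is the Dirac measure at $0$, and $Z_{\varepsilon,\Lambda}[\eta]$ is the normalizing constant (partition function). $\mu_{\varepsilon,\Lambda}[\eta](f)$ denotes the expectation of $f$ under this measure. $\Lambda_L$ is the cube of sidelength $2L+1$ in $\mathbb{Z}^d$ centered at the origin. $\mathbb{E}$ is the expectation over the random fields $\eta$. $\Delta$ is the lattice Laplace operator on $\mathbb{Z}^d$. Its finite-volume version $\Delta_\Lambda$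 (zero boundary condition) is the one entering the Gaussian identity $Z^{\mathrm{Gauss}}_{0,\Lambda}[\eta]=\exp\bigl(\frac12\sum_{i,j\in\Lambda}(-\Delta_\Lambda)^{-1}_{i,j}\eta_i\eta_j\bigr)Z^{\mathrm{Gauss}}_{0,\Lambda}[0]$, where $Z^{\mathrm{Gauss}}_{0,\Lambda}[\eta]$ is the partition function with $V(t)=t^2/2$ and $\varepsilon=0$. *)

(* Defs.v *)
From HB Require Import structures.
From mathcomp Require Import all_boot all_order all_algebra finmap.
From mathcomp Require Import all_classical all_reals all_analysis.
From mathcomp Require Import zify ring.
Import Order.TTheory GRing.Theory Num.Theory.
Import numFieldNormedType.Exports.

Set Implicit Arguments.
Unset Strict Implicit.
Unset Printing Implicit Defensive.

Local Open Scope classical_set_scope.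
Local Open Scope ring_scope.

Notation site d := 'rV[int]_d.

Definition neighbors (d : nat) (i : site d) : seq (site d) :=
  [seq i + delta_mx 0 k | k <- enum 'I_d] ++
  [seq i - delta_mx 0 k | k <- enum 'I_d].

Lemma neighbors_sym d (i j : site d) : (j \in neighbors i) = (i \in neighbors j).
Proof.
rewrite !mem_cat orbC; congr (_ || _); apply/mapP/mapP => -[k kd ->];
  by exists k; rewrite ?addrK ?subrK.
Qed.

Lemma neighbors_uniq d (i : site d) : uniq (neighbors i).
Proof.
have dinj (k l : 'I_d) : delta_mx 0 k = delta_mx 0 l :> site d -> k = l.
  move=> /rowP/(_ k); rewrite !mxE !eqxx /=.
  by case: eqVneq.
rewrite cat_uniq; apply/and3P; split.
- by rewrite map_inj_uniq ?enum_uniq// => k l /addrI /dinj.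
- apply/hasPn => _ /mapP[k _ ->]; apply/negP => /mapP[l _].
  move=> /addrI /rowP/(_ k); rewrite !mxE !eqxx /=.
  by case: eqVneq.
- by rewrite map_inj_uniq ?enum_uniq// => k l /addrI /oppr_inj /dinj.
Qed.

Definition box (d L : nat) : {fset site d} :=
  [fset i in [seq \row_(k < d) ((x 0 k : nat)%:Z - L%:Z)
               | x : 'rV['I_(L.*2.+1)]_d]]%fset.

Lemma in_box d L (i : site d) :
  (i \in box d L) = [forall k, `|i 0 k| <= L%:Z].
Proof.
rewrite inE; apply/fintype.imageP/forallP => [[x _ ->] k|iL].
  have := ltn_ord (x 0 k); rewrite mxE; move: (nat_of_ord (x 0 k)) => m.
  by rewrite ler_norml; lia.
exists (\row_k inord (absz (i 0 k + L%:Z))) => //.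
apply/rowP => k; rewrite !mxE; move: (iL k); rewrite ler_norml.
  move: (i 0 k) => z zL; by rewrite inordK; lia.
Qed.

Section gibbs.
Context {R : realType} {d : nat}.
Implicit Types (V : R -> R) (Lam : {fset site d}) (f h : site d -> R).

(* The half undoes the double count of unordered pairs, so the value does not
   depend on how a pair is oriented, whether or not V is even. *)
Definition energy V Lam f : R :=
  (4 * d%:R)^-1 *
    (2^-1 * \sum_(i <- Lam) \sum_(j <- neighbors i | j \in Lam) V (f i - f j)) +
  (4 * d%:R)^-1 *
    (\sum_(i <- Lam) \sum_(j <- neighbors i | j \notin Lam) V (f i)).

(* Normalised so that the energy of V(t) = t^2 / 2 is the quadratic form
   (f, - Delta f) / 2, which is energy_gaussian below. *)
Definition laplacian f (i : site d) : R :=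
  (4 * d%:R)^-1 * \sum_(j <- neighbors i) (f j - f i).

Lemma energy_gaussian Lam f : (forall i, i \notin Lam -> f i = 0) ->
  energy (fun t => t ^+ 2 / 2) Lam f =
  2^-1 * \sum_(i <- Lam) f i * - laplacian f i.
Proof.
move=> f0.
have inE (F : site d -> site d -> R) i :
    \sum_(j <- neighbors i | j \in Lam) F i j =
    \sum_(j <- Lam | j \in neighbors i) F i j.
  rewrite -big_filter -[RHS]big_filter; apply: perm_big; apply: uniq_perm.
  - exact/filter_uniq/neighbors_uniq.
  - exact/filter_uniq/fset_uniq.
  - by move=> j; rewrite !mem_filter andbC.
pose S := \sum_(i <- Lam) \sum_(j <- neighbors i | j \in Lam) f i * (f i - f j).
have SE : \sum_(i <- Lam) \sum_(j <- neighbors i | j \in Lam)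
    (f i - f j) ^+ 2 / 2 = S.
  have S' : S = \sum_(i <- Lam) \sum_(j <- neighbors i | j \in Lam)
      f j * (f j - f i).
    rewrite /S; under eq_bigr do rewrite (inE (fun i j => f i * (f i - f j))).
    rewrite (exchange_big_dep xpredT)//=; apply: eq_bigr => i _.
    rewrite (inE (fun i j => f j * (f j - f i))).
    by apply: eq_bigl => j; rewrite neighbors_sym.
  have -> : S = (S + S) / 2 by field.
  rewrite {2}S' -big_split /= mulr_suml; apply: eq_bigr => i _.
  rewrite -big_split /= mulr_suml; apply: eq_bigr => j _; by field.
rewrite /energy SE /S -mulrDr mulr_sumr -big_split /= mulr_sumr mulr_sumr.
apply: eq_bigr => i _.
have -> : laplacian f i = (4 * d%:R)^-1 *
    (\sum_(j <- neighbors i | j \in Lam) (f j - f i) +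
     \sum_(j <- neighbors i | j \notin Lam) (- f i)).
  rewrite /laplacian (bigID (fun j => j \in Lam))/=; congr (_ * (_ + _)).
  by apply: eq_bigr => j /f0 ->; rewrite sub0r.
rewrite -mulr_sumr.
have -> : \sum_(j <- neighbors i | j \in Lam) (f i - f j) =
    - \sum_(j <- neighbors i | j \in Lam) (f j - f i).
  by rewrite -sumrN; apply: eq_bigr => j _; rewrite opprB.
have -> : \sum_(j <- neighbors i | j \notin Lam) f i ^+ 2 / 2 =
    f i / 2 * - \sum_(j <- neighbors i | j \notin Lam) (- f i).
  by rewrite -sumrN mulr_sumr; apply: eq_bigr => j _; rewrite opprK; field.
ring.
Qed.

End gibbs.

Section power_measure.
Local Open Scope ereal_scope.
Context {R : realType}.
Notation RT := (measurableTypeR R).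

Definition pinned_lebesgue (eps : {nonneg R}) : set RT -> \bar R :=
  measure_add lebesgue_measure (mscale eps (\d_((0%R : R) : RT))).

HB.instance Definition _ eps := Measure.on (pinned_lebesgue eps).

Let sigma_finite_pinned_lebesgue eps : sigma_finite setT (pinned_lebesgue eps).
Proof.
have [F FT Foo] := sigma_finiteT (@lebesgue_measure R).
exists F => // i; have [mF Fi] := Foo i; split => //.
rewrite /pinned_lebesgue measure_addE lte_add_pinfty//.
exact: (ltry (eps%:num * \1_(F i) (0%R : R))).
Qed.

HB.instance Definition _ eps := Measure_isSigmaFinite.Build _ _ _
  (pinned_lebesgue eps) (sigma_finite_pinned_lebesgue eps).

Definition tcons n (p : RT * n.-tuple RT) : n.+1.-tuple RT := [tuple of p.1 :: p.2].

Fixpoint power_measure (m : set RT -> \bar R) n : set (n.-tuple RT) -> \bar R :=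
  if n is n'.+1 then
    pushforward (m \x @power_measure m n') (@tcons n')
  else \d_([tuple] : 0.-tuple RT).

Arguments power_measure m n _ : clear implicits.

Let measurable_tcons n : measurable_fun setT (@tcons n).
Proof. exact: measurable_cons. Qed.

HB.instance Definition _ n := isMeasurableFun.Build _ _ _ _ (@tcons n)
  (@measurable_tcons n).

Let power_measureP (m : {sigma_finite_measure set RT -> \bar R}) n :
  exists mu : {sigma_finite_measure set (n.-tuple RT) -> \bar R},
    mu = power_measure m n :> (set _ -> \bar R).
Proof.
elim: n => [|n [mu muE]]; first by exists (\d_([tuple] : 0.-tuple RT)).
pose p (A : set (n.+1.-tuple RT)) := (m \x mu) (@tcons n @^-1` A).
have sf : sigma_finite setT p.
  have [F FT Foo] : sigma_finite setT (m \x mu).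
    have /sigma_finiteP[F [TF ndF Foo]] := sigma_finiteT m.
    have /sigma_finiteP[G [TG ndG Goo]] := sigma_finiteT mu.
    exists (fun k => F k `*` G k) => [|k].
      rewrite -setXTT TF TG predeqE => -[x y]; split.
        move=> [/= [k _ Fkx] [l _ Gly]]; exists (maxn k l) => //; split.
        - by move: x Fkx; exact/subsetPset/ndF/leq_maxl.
        - by move: y Gly; exact/subsetPset/ndG/leq_maxr.
      by move=> [k _ []/= ? ?]; split; exists k.
    have [? ?] := Foo k; have [? ?] := Goo k.
    split; first exact: measurableX.
    by rewrite product_measure1E// lte_mul_pinfty// ge0_fin_numE.
  pose g (t : n.+1.-tuple RT) : RT * n.-tuple RT := (thead t, [tuple of behead t]).
  have mg : measurable_fun setT g.
    by apply/measurable_fun_pairP; split;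
      [exact: measurable_tnth|exact: measurable_behead].
  have gK (q : RT * n.-tuple RT) : g (tcons q) = q.
    by case: q => a t; congr pair; apply: val_inj.
  exists (fun i => g @^-1` F i) => [|i].
    by rewrite -preimage_bigcup -FT preimage_setT.
  have [mF Fi] := Foo i; split; first by rewrite -[_ @^-1` _]setTI; exact: mg.
  rewrite /p -comp_preimage.
  by rewrite (_ : g \o _ = id) ?preimage_id//; exact/funext.
have pT A : measurable A -> measurable (@tcons n @^-1` A).
  by move=> mA; rewrite -[X in measurable X]setTI; exact: measurable_tcons.
have p0 : p set0 = 0 by rewrite /p preimage_set0 measure0.
have p_ge0 A : 0 <= p A by exact: measure_ge0.
have p_sigma : semi_sigma_additive p.
  move=> F mF tF mUF; rewrite /p preimage_bigcup.
  apply: measure_semi_sigma_additive.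
  - by move=> k; exact: pT.
  - apply/trivIsetP => /= i j _ _ ij; rewrite -preimage_setI.
    by move/trivIsetP : tF => /(_ _ _ _ _ ij) ->//; rewrite preimage_set0.
  - by rewrite -preimage_bigcup; exact: pT.
pose I := isMeasure.Build _ _ _ p p0 p_ge0 p_sigma.
pose pm : {measure set (n.+1.-tuple RT) -> \bar R} := HB.pack p I.
pose S := Measure_isSigmaFinite.Build _ _ _ pm sf.
pose mu' : {sigma_finite_measure set (n.+1.-tuple RT) -> \bar R} :=
  HB.pack p I S.
by exists mu'; rewrite /= -muE.
Qed.

Section instances.
Variables (m : {sigma_finite_measure set RT -> \bar R}) (n : nat).

Let power_measure0 : power_measure m n set0 = 0.
Proof. by have [mu <-] := power_measureP m n; exact: measure0. Qed.

Let power_measure_ge0 A : 0 <= power_measure m n A.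
Proof. by have [mu <-] := power_measureP m n; exact: measure_ge0. Qed.

Let power_measure_semi_sigma_additive : semi_sigma_additive (power_measure m n).
Proof.
by have [mu <-] := power_measureP m n; exact: measure_semi_sigma_additive.
Qed.

HB.instance Definition _ := isMeasure.Build _ _ _ (power_measure m n)
  power_measure0 power_measure_ge0 power_measure_semi_sigma_additive.

Let sigma_finite_power_measure : sigma_finite setT (power_measure m n).
Proof. by have [mu <-] := power_measureP m n; exact: sigma_finiteT. Qed.

HB.instance Definition _ := Measure_isSigmaFinite.Build _ _ _
  (power_measure m n) sigma_finite_power_measure.

End instances.
End power_measure.
Arguments power_measure {R} m n _.

Section gibbs_measure.
Context {R : realType} {d : nat}.
Notation RT := (measurableTypeR R).
Implicit Types (V : R -> R) (eps : {nonneg R}) (Lam : {fset site d}).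
Implicit Types (h : site d -> R).

(* index i Lam is out of range for i outside Lam: zero boundary condition. *)
Definition spin Lam (phi : #|` Lam|.-tuple RT) (i : site d) : R :=
  nth (0 : R) phi (index i Lam).

Definition boltzmann_weight V Lam h (phi : #|` Lam|.-tuple RT) : R :=
  expR (- energy V Lam (spin phi) + \sum_(i <- Lam) h i * spin phi i).

Definition reference_measure eps Lam : set (#|` Lam|.-tuple RT) -> \bar R :=
  power_measure (pinned_lebesgue eps) #|` Lam|.
Arguments reference_measure eps Lam _ : clear implicits.

Definition partition_function V eps Lam h : \bar R :=
  (\int[reference_measure eps Lam]_phi (boltzmann_weight V h phi)%:E)%E.

Definition gibbs V eps Lam h (A : set (#|` Lam|.-tuple RT)) : \bar R :=
  ((fine (partition_function V eps Lam h))^-1%:E *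
   \int[reference_measure eps Lam]_(phi in A)
     (boltzmann_weight V h phi)%:E)%E.

Arguments gibbs V eps Lam h _ : clear implicits.

Definition gibbs_mean V eps Lam h (f : #|` Lam|.-tuple RT -> R) : R :=
  fine (\int[gibbs V eps Lam h]_phi (f phi)%:E)%E.

End gibbs_measure.
Arguments reference_measure {R d} eps Lam _.
Arguments gibbs {R d} V eps Lam h _.
Arguments gibbs_mean {R d} V eps Lam h f.

Section laplacian_inverse.
Context {R : realType} {d : nat}.

Definition vanishes_at_infinity (g : site d -> R) : Prop :=
  forall e : R, 0 < e -> finite_set [set i | e <= `|g i|].

(* In d >= 3 the columns of the inverse vanish at infinity but need not be
   square summable, so - Delta is inverted on functions vanishing at infinity. *)
Definition is_inverse_neg_laplacian (G : site d -> site d -> R) : Prop :=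
  forall j, (forall i, - laplacian (G ^~ j) i = (i == j)%:R) /\
            vanishes_at_infinity (G ^~ j).

End laplacian_inverse.

Definition abs_infty (R : realType) : set_system R :=
  [set A | exists M : R, forall t : R, M < `|t| -> A t].
Arguments abs_infty R _ : clear implicits.

Section iid.
Context {disp : measure_display} {Omega : measurableType disp} {R : realType}.
Context {P : probability Omega R} {I : choiceType}.
Implicit Types X : I -> {RV P >-> R}.

Definition mutually_independent X : Prop :=
  forall (s : seq I) (A : I -> set R), uniq s ->
    (forall i, i \in s -> measurable (A i)) ->
    P (\bigcap_(i in [set` s]) (X i @^-1` A i)) =
    (\prod_(i <- s) P (X i @^-1` A i))%E.

Definition identically_distributed X : Prop :=
  forall i j (A : set R), measurable A ->
    distribution P (X i) A = distribution P (X j) A.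

Definition symmetrically_distributed X : Prop :=
  forall i (A : set R), measurable A ->
    distribution P (X i) A = distribution P (X i) (-%R @^-1` A).

End iid.

(* Main.v *)
Require Import Defs.
From HB Require Import structures.
From mathcomp Require Import all_boot all_order all_algebra finmap.
From mathcomp Require Import all_classical all_reals all_analysis.
From mathcomp Require Import measurable_realfun.
From mathcomp Require Import zify ring lra.
Import Order.TTheory GRing.Theory Num.Theory.
Import numFieldNormedType.Exports.

Set Implicit Arguments.
Unset Strict Implicit.
Unset Printing Implicit Defensive.

Local Open Scope classical_set_scope.
Local Open Scope ring_scope.

(* By Jensen's inequality the sum S = \sum_(i in Lam) eta_i mu[eta](phi_i)
   satisfies S >= ln Z[eta] - ln Z[0], and S is at least the same sum taken with
   mu[0], whose expectation vanishes. Hence E S >= 0, which lets |Lam_L| be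
   replaced by L^d, and it remains to bound ln Z[eta] - ln Z[0] from below.
   Superlinearity of V gives ln Z[0] <= |Lam| ln (b1 + b2 eps): keep only the
   increments along a spanning forest and integrate the sites out one by one.
   For ln Z[eta], drop the atoms and shift the unit cube by
   u = \sum_j eta_j T_j; as V'' <= 1, the cost of the shift is at most Gaussian,
   up to a term linear in eta, so that the diagonal terms in eta give
   E(eta_0^2) \sum_j (T_j(j) - (T_j, - Delta T_j) / 2). For the truncated Green
   function T_j = (G(., j) - m)_+, which has finite range, every summand is at
   least (G(0, 0) - m) / 2; finally m tends to 0.
   The Green function itself is the increasing limit of the expected local time
   of the random walk, kept finite and vanishing at infinity by the
   superharmonic function (C + |x|^2)^(-1/4). *)

(** * The lattice Green function *)

(** The natural shift would use the Green function of the box, but then its diagonal would have to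
    be shown to converge to G(0, 0). The truncation (G - m)_+ avoids this: it is the same function
    around every centre, and only the centres close to the boundary of the box have to be given up.
    The factor 1/2 in the bound is what remains of T_j(j) once the Gaussian cost, at most T_j(j) /
    2, is paid. The coefficients of the terms linear in eta are never computed: they do not depend
    on eta, so symmetry of the law removes them, and independence does the same to the off-diagonal
    products. Positivity of E S matters because |Lam_L| is about 2^d L^d: a negative lower bound per
    site would get worse after division by L^d. As V may grow more slowly than a quadratic function,
    S need not be integrable; each lower bound on E S therefore comes from an integrable minorant,
    and E S = +oo is allowed. In b1 + b2 eps, the first constant stems from Lebesgue measure and the
    second from the atom, once per site. *)

Lemma inv_fourth_root_le (R : realType) (r s : R) : 0 < r -> `|s| <= 100^-1 ->
  (Num.sqrt (Num.sqrt (r * (1 + s))))^-1 <=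
  (Num.sqrt (Num.sqrt r))^-1 * (1 - s / 4 + 3 / 16 * s ^+ 2).
Proof.
move=> r0; rewrite ler_norml => /andP[s1 s2].
(* The Taylor coefficient of [s ^+ 2] is 5/32. Raising it to 3/16 leaves room for the higher-order
   terms, and 3/16 is the largest value for which the leading terms in [barrier_superharmonic] still
   balance in dimension 3. *)
set p := 1 - s / 4 + 3 / 16 * s ^+ 2.
have p0 : 0 < p by rewrite /p; nra.
(* Both squarings round the quadratic coefficient down, from 7/16 to 43/100 and from 111/100 to
   110/100. The slack absorbs the cubic terms; the quartic ones are nonnegative. *)
have p2 : 1 - s / 2 + 43 / 100 * s ^+ 2 <= p ^+ 2.
  rewrite -subr_ge0.
  have -> : p ^+ 2 - (1 - s / 2 + 43 / 100 * s ^+ 2) =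
     s ^+ 2 * (1 / 16 + 6 / 16 - 43 / 100 - 3 / 32 * s + 9 / 256 * s ^+ 2).
    by rewrite /p; field.
  by rewrite mulr_ge0 ?sqr_ge0//; have := sqr_ge0 s; clear -s1 s2; move: (s ^+ 2) => t; lra.
have q0 : 0 <= 1 - s / 2 + 43 / 100 * s ^+ 2 by nra.
have p4 : 1 - s + 110 / 100 * s ^+ 2 <= p ^+ 4.
  rewrite (_ : 4 = 2 * 2)%N// exprM.
  apply: (@le_trans _ _ ((1 - s / 2 + 43 / 100 * s ^+ 2) ^+ 2)); last first.
    by rewrite ler_sqr// nnegrE ?exprn_ge0// ltW.
  rewrite -subr_ge0.
  have -> : (1 - s / 2 + 43 / 100 * s ^+ 2) ^+ 2 - (1 - s + 110 / 100 * s ^+ 2) =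
     s ^+ 2 * (1 / 100 - 43 / 100 * s + (43 / 100 * s) ^+ 2) by field.
  by rewrite mulr_ge0 ?sqr_ge0// addr_ge0 ?sqr_ge0//; clear -s1 s2; lra.
have p5 : 1 <= p ^+ 4 * (1 + s).
  apply: (@le_trans _ _ ((1 - s + 110 / 100 * s ^+ 2) * (1 + s))); last first.
    by rewrite ler_wpM2r//; lra.
  rewrite -subr_ge0.
  have -> : (1 - s + 110 / 100 * s ^+ 2) * (1 + s) - 1 =
     s ^+ 2 * (1 / 10 + 110 / 100 * s) by field.
  by rewrite mulr_ge0 ?sqr_ge0//; lra.
have s0 : 0 < 1 + s by lra.
rewrite (sqrtrM _ (ltW r0)) sqrtrM ?sqrtr_ge0// invfM. apply: ler_wpM2l; first by rewrite invr_ge0 sqrtr_ge0.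
set y := Num.sqrt (Num.sqrt (1 + s)).
have y0 : 0 < y by rewrite !sqrtr_gt0.
have y4 : y ^+ 4 = 1 + s.
  by rewrite (_ : 4 = 2 * 2)%N// exprM !sqr_sqrtr ?sqrtr_ge0 ?ltW.
rewrite -div1r ler_pdivrMr//.
have : 1 <= (p * y) ^+ 4 by rewrite exprMn y4.
case: (leP 1 (p * y)) => // py1; rewrite leNgt exprn_ilt1//.
by rewrite mulr_ge0 ?ltW.
Qed.

(** * Maximum principle for the lattice Laplacian *)

Section laplacian_theory.
Context {R : realType} {d : nat}.
Implicit Types (f g : site d -> R) (i j : site d).

Lemma sum_neighbors (F : site d -> R) i :
  \sum_(j <- neighbors i) F j =
  \sum_(k < d) (F (i + delta_mx 0 k) + F (i - delta_mx 0 k)).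
Proof. have E (g : 'I_d -> R) : \sum_(k <- enum 'I_d) g k = \sum_(k < d) g k.
  by rewrite big_enum.
by rewrite big_split -!E big_cat !big_map. Qed.

Lemma size_neighbors i : size (neighbors i) = (2 * d)%N.
Proof.
rewrite /neighbors; move: (size_enum_ord d); move: (enum 'I_d) => s sd.
by rewrite size_cat !size_map sd mul2n addnn.
Qed.

Lemma laplacian_shift f i j : laplacian (fun x => f (x - j)) i = laplacian f (i - j).
Proof.
rewrite /laplacian !sum_neighbors; congr (_ * _).
by apply: eq_bigr => k _; rewrite ![i + _ - j]addrAC.
Qed.

Lemma laplacianB f g i :
  laplacian (fun x => f x - g x) i = laplacian f i - laplacian g i.
Proof.
rewrite /laplacian -mulrBr; congr (_ * _); rewrite -sumrB.
by apply: eq_bigr => k _; ring.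
Qed.

(** A positive value would force a maximum to be attained, since superlevel sets are finite.
    Subharmonicity spreads the maximum to all neighbours, hence along a half-line, and the
    superlevel set would be infinite. *)
Lemma subharmonic_le0 f : (0 < d)%N -> (forall i, 0 <= laplacian f i) ->
  vanishes_at_infinity f -> forall i, f i <= 0.
Proof.
move=> d0 lap0 fv i0; rewrite leNgt; apply/negP => fi0.
have fin : finite_set [set i | f i0 <= f i].
  by apply: sub_finite_set (fv _ fi0) => i /= /le_trans; apply; exact: ler_norm.
have [im [fim imax]] : exists im, f i0 <= f im /\ forall j, f j <= f im.
  pose A := fset_set [set i | f i0 <= f i].
  have i0A : i0 \in A by rewrite in_fset_set//; apply/mem_set; exact: lexx.
  pose im := [arg max_(i > [` i0A]%fset) f (val i)]%O.
  have imP (j : A) : f (val j) <= f (val im).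
    by rewrite /im; case: arg_maxP => //= k _; apply.
  exists (val im); split; first by have := valP im; rewrite in_fset_set ?inE.
  move=> j; have [jA|] := boolP (j \in A); first exact: (imP [` jA]%fset).
  rewrite in_fset_set// notin_setE /= => /negP; rewrite -ltNge => /ltW/le_trans.
  by apply; exact: (imP [` i0A]%fset).
have nb i j : f i = f im -> j \in neighbors i -> f j = f im.
  move=> fi ji.
  have : \sum_(k <- neighbors i) (f im - f k) = 0.
    apply/le_anti/andP; split; last first.
      by apply: sumr_ge0 => k _; rewrite subr_ge0.
    have := lap0 i; rewrite /laplacian pmulr_rge0 ?invr_gt0 ?mulr_gt0 ?ltr0n//.
    rewrite -oppr_le0 -sumrN; apply: le_trans; rewrite le_eqVlt; apply/orP; left.
    by apply/eqP/eq_bigr => k _; rewrite fi opprB.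
  move/eqP; rewrite psumr_eq0 => [/allP/(_ _ ji)/=|k _]; last by rewrite subr_ge0.
  by rewrite subr_eq0 => /eqP.
pose k0 := Ordinal d0.
pose e : nat -> site d := fun n => im + (delta_mx 0 k0) *+ n.
have eN n : f (e n) = f im.
  elim: n => [|n IH]; first by rewrite /e addr0.
  apply: (nb (e n)) => //; rewrite mem_cat; apply/orP; left.
  by apply/mapP; exists k0; rewrite ?mem_enum// /e mulrSr addrA.
have einj : injective e.
  move=> m n /addrI/rowP/(_ k0); rewrite !mulmxnE !mxE !eqxx /=.
  by lia.
apply: infinite_nat.
have -> : [set: nat] = e @^-1` [set i | f i0 <= f i].
  by apply/seteqP; split=> // n _ /=; rewrite eN.
by apply: finite_preimage fin => m n _ _; exact: einj.
Qed.

Lemma harmonic_eq f g : (0 < d)%N -> (forall i, laplacian f i = laplacian g i) ->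
  vanishes_at_infinity f -> vanishes_at_infinity g -> f = g.
Proof.
move=> d0 lap vf vg.
have vB (p q : site d -> R) : vanishes_at_infinity p -> vanishes_at_infinity q ->
    vanishes_at_infinity (fun x => p x - q x).
  move=> vp vq e e0; have e20 : 0 < e / 2 by rewrite divr_gt0.
  have : finite_set ([set i | e / 2 <= `|p i|] `|` [set i | e / 2 <= `|q i|]).
    by rewrite finite_setU; split; [exact: vp|exact: vq].
  apply: sub_finite_set => i /= epq; apply/orP.
  rewrite -[_ || _]negbK negb_or -!ltNge; apply/negP => /andP[h1 h2].
  by have := le_trans epq (ler_normB _ _); lra.
apply/funext => i; apply/le_anti/andP; split; rewrite -subr_le0.
- apply: (@subharmonic_le0 (fun x => f x - g x)) => // [j|]; last exact: vB.
  by rewrite laplacianB lap subrr.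
- apply: (@subharmonic_le0 (fun x => g x - f x)) => // [j|]; last exact: vB.
  by rewrite laplacianB lap subrr.
Qed.

End laplacian_theory.

(** * Superharmonic barrier and expected local time *)

Section green_function.
Context {R : realType} {d : nat}.
Hypothesis d3 : (3 <= d)%N.
Implicit Types (f g : site d -> R) (i j : site d).

Definition sqnorm i : R := \sum_(k < d) (i 0 k)%:~R ^+ 2.

Lemma sqnorm_ge0 i : 0 <= sqnorm i.
Proof. by apply: sumr_ge0 => k _; rewrite sqr_ge0. Qed.

Lemma sqnormD_delta i (k : 'I_d) (b : R) : b ^+ 2 = 1 ->
  forall j, j = i + delta_mx 0 k *~ (if b == 1 then 1 else -1) ->
  sqnorm j = sqnorm i + 1 + 2 * b * (i 0 k)%:~R.
Proof.
move=> b1 j ->; rewrite /sqnorm (bigD1 k)//= [in RHS](bigD1 k)//=.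
have -> : \sum_(l < d | l != k)
    ((i + delta_mx 0 k *~ (if b == 1 then 1 else -1)) 0 l)%:~R ^+ 2 =
    \sum_(l < d | l != k) (i 0 l)%:~R ^+ 2 :> R.
  apply: eq_bigr => l lk; rewrite !mxE.
  by case: ifP => _; rewrite ?mulr1z ?mulrN1z !mxE (negbTE lk) andbF ?oppr0 addr0.
move: b1 => /eqP; rewrite sqrf_eq1 => /orP[]/eqP ->.
  by rewrite eqxx mulr1z !mxE !eqxx/= intrD; ring.
rewrite (_ : -1 == 1 = false); last by apply/eqP; lra.
by rewrite mulrN1z !mxE !eqxx/= intrD rmorphN/=; ring.
Qed.

Lemma sqnormD i (k : 'I_d) : sqnorm (i + delta_mx 0 k) = sqnorm i + 1 + 2 * (i 0 k)%:~R.
Proof.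
by rewrite (@sqnormD_delta i k 1) ?expr1n// ?mulr1// eqxx mulr1z.
Qed.

Lemma sqnormB i (k : 'I_d) : sqnorm (i - delta_mx 0 k) = sqnorm i + 1 - 2 * (i 0 k)%:~R.
Proof.
rewrite (@sqnormD_delta i k (-1)) ?sqrrN ?expr1n//; first by ring.
by rewrite (_ : -1 == 1 = false) ?mulrN1z//; apply/eqP; lra.
Qed.

(* Large enough for every neighbour j of i to satisfy
   |sqnorm j - sqnorm i| <= (barrier_shift + sqnorm i) / 100. *)
Definition barrier_shift : R := 3 * 100 ^+ 2.

Let shift_ge : 100 ^+ 2 + 100 <= barrier_shift.
Proof. by rewrite /barrier_shift expr2; lra. Qed.

Lemma barrier_shift_gt0 : 0 < barrier_shift.
Proof. by rewrite mulr_gt0. Qed.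

(** A smooth stand-in for |x|^(-1/2). In the continuum |x|^(-a) is superharmonic for 0 < a <= d - 2;
    taking a = 1/2 instead of the critical 1 of dimension 3 leaves room for the lattice errors. *)
Definition barrier i : R := (Num.sqrt (Num.sqrt (barrier_shift + sqnorm i)))^-1.

Lemma barrier_gt0 i : 0 < barrier i.
Proof. by rewrite invr_gt0 !sqrtr_gt0 ltr_wpDr ?sqnorm_ge0// barrier_shift_gt0. Qed.

Lemma sqr_coord_le i (k : 'I_d) : (i 0 k)%:~R ^+ 2 <= sqnorm i.
Proof.
by rewrite /sqnorm (bigD1 k)//= lerDl; apply: sumr_ge0 => l _; rewrite sqr_ge0.
Qed.

(** Relative to [barrier i], the first-order terms sum to - d / (2 r) and the second-order ones to 3
    |i|^2 / (2 r^2) + 3 d / (8 r^2), where r is the shifted square norm. For d >= 3 the former wins;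
    in dimension 3 the |i|^2 parts cancel and the shift decides. *)
Lemma barrier_superharmonic i :
  \sum_(j <- neighbors i) barrier j <= (2 * d)%:R * barrier i.
Proof.
rewrite sum_neighbors; set r := barrier_shift + sqnorm i.
have r0 : 0 < r by rewrite ltr_wpDr ?sqnorm_ge0// barrier_shift_gt0.
pose p (s : R) := 1 - s / 4 + 3 / 16 * s ^+ 2.
have B (k : 'I_d) (b : R) j : b ^+ 2 = 1 -> 
    sqnorm j = sqnorm i + 1 + 2 * b * (i 0 k)%:~R ->
    barrier j <= barrier i * p ((1 + 2 * b * (i 0 k)%:~R) / r).
  move=> b1 jE; rewrite /barrier -/r.
  have -> : barrier_shift + sqnorm j = r * (1 + (1 + 2 * b * (i 0 k)%:~R) / r).
    by rewrite mulrDr mulr1 mulrCA divff ?gt_eqF// mulr1 jE /r; ring.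
  apply: inv_fourth_root_le => //.
  rewrite normrM normfV (gtr0_norm r0) ler_pdivrMr//.
  have := sqr_coord_le i k; rewrite /r; set x := (i 0 k)%:~R => xi.
  apply: (@le_trans _ _ (1 + 2 * `|x|)).
    rewrite (le_trans (ler_normD _ _))// normr1 lerD2l !normrM ger0_norm//.
    move/eqP: b1; rewrite sqrf_eq1 => /orP[]/eqP ->; by rewrite ?normrN normr1 mulr1.
  have : `|x| ^+ 2 = x ^+ 2 by rewrite -normrX ger0_norm// sqr_ge0.
  move: xi; set y := `|x| => + y2; rewrite -y2 => xi.
  (* The goal 100 + 200 y <= r follows from (y - 100)^2 >= 0 and the size of the shift. *)
  have := sqr_ge0 (y - 100); rewrite sqrrB => h.
  by move: h xi shift_ge; move: (100 ^+ 2) (y ^+ 2) => u v; lra.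
apply: (@le_trans _ _ (\sum_(k < d) barrier i *
   (p ((1 + 2 * 1 * (i 0 k)%:~R) / r) + p ((1 + 2 * -1 * (i 0 k)%:~R) / r)))).
  apply: ler_sum => k _; rewrite mulrDr lerD//; apply: B.
  - by rewrite expr1n.
  - by rewrite sqnormD mulr1.
  - by rewrite sqrrN expr1n.
  - by rewrite sqnormB; ring.
rewrite -mulr_sumr mulrC ler_pM2r ?barrier_gt0//.
have -> : \sum_(k < d)
   (p ((1 + 2 * 1 * (i 0 k)%:~R) / r) + p ((1 + 2 * -1 * (i 0 k)%:~R) / r)) =
   \sum_(k < d) ((2 - 1 / 2 / r + 3 / 8 / r ^+ 2) + 3 / 2 / r ^+ 2 * (i 0 k)%:~R ^+ 2).
  by apply: eq_bigr => k _; rewrite /p; field; rewrite gt_eqF.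
rewrite big_split/= -mulr_sumr sumr_const card_ord -/(sqnorm i) -[_ *+ d]mulr_natl natrM.
rewrite -subr_ge0.
have -> : 2 * d%:R - (d%:R * (2 - 1 / 2 / r + 3 / 8 / r ^+ 2) +
     3 / 2 / r ^+ 2 * sqnorm i) =
   (d%:R * (1 / 2 * r - 3 / 8) - 3 / 2 * sqnorm i) / r ^+ 2.
  by field; rewrite gt_eqF.
apply: divr_ge0; last by rewrite exprn_ge0 ?ltW.
rewrite subr_ge0.
apply: (@le_trans _ _ (3 * (1 / 2 * r - 3 / 8))).
  by rewrite /r; have := sqnorm_ge0 i; have := shift_ge; rewrite expr2; lra.
apply: ler_wpM2r; last by rewrite (ler_nat _ 3).
by rewrite /r; have := sqnorm_ge0 i; have := shift_ge; rewrite expr2; lra.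
Qed.

(** The strict defect at the origin is what pays for the source term of the local-time recursion. *)
Lemma barrier_strict :
  \sum_(j <- neighbors (0 : site d)) barrier j < (2 * d)%:R * barrier 0.
Proof.
have d0 : (0 < d)%N by exact: leq_trans d3.
rewrite sum_neighbors.
have s0 : sqnorm (0 : site d) = 0 :> R.
  by rewrite /sqnorm big1// => k _; rewrite mxE expr0n.
have bE k : (barrier (0 + delta_mx 0 k) + barrier (0 - delta_mx 0 k) : R) =
    2 * (Num.sqrt (Num.sqrt (barrier_shift + 1)))^-1.
  rewrite /barrier sqnormD sqnormB mxE s0 mulr0 addr0 subr0 add0r.
  by rewrite -mulr2n mulr_natl.
under eq_bigr do rewrite bE.
rewrite sumr_const card_ord -[_ *+ d]mulr_natl natrM mulrCA mulrA ltr_pM2l.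
  have c0 := barrier_shift_gt0; have c1 : 0 < barrier_shift + 1 by lra.
  rewrite /barrier s0 addr0 ltf_pV2 ?posrE ?sqrtr_gt0//.
  by rewrite !ltr_sqrt ?sqrtr_gt0 ?ltrDl//.
by rewrite mulr_gt0// ltr0n.
Qed.

Lemma finite_box_subset L (A : set (site d)) :
  (forall i, A i -> i \in box d L) -> finite_set A.
Proof. by move=> Abox; apply: (@sub_finite_set _ _ [set` box d L]) => // i /Abox. Qed.

Lemma barrier_vanishes (k : R) : 0 < k ->
  vanishes_at_infinity (fun i => k * barrier i).
Proof.
move=> k0 e e0.
have ke0 : 0 < k / e by rewrite divr_gt0.
apply: (@finite_box_subset (Num.bound ((k / e) ^+ 4)).+1) => i /=.
have kb0 : 0 <= k * barrier i by exact: ltW (mulr_gt0 k0 (barrier_gt0 i)).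
rewrite ger0_norm// mulrC -ler_pdivrMr// -[e / k]invrK invf_div.
rewrite /barrier lef_pV2 ?posrE//; last first.
  by rewrite !sqrtr_gt0 ltr_wpDr ?sqnorm_ge0// barrier_shift_gt0.
move=> h.
have sq : sqnorm i <= (k / e) ^+ 4.
  have s0 : 0 <= barrier_shift + sqnorm i by rewrite addr_ge0 ?sqnorm_ge0 ?ltW ?barrier_shift_gt0.
  apply: (@le_trans _ _ (barrier_shift + sqnorm i)).
    by rewrite lerDr ltW ?barrier_shift_gt0.
  rewrite -(sqr_sqrtr s0) -(sqr_sqrtr (sqrtr_ge0 _)) -exprM.
  by apply: lerXn2r => //; rewrite nnegrE ?sqrtr_ge0// ltW.
rewrite in_box; apply/forallP => l.
have := le_lt_trans (le_trans (sqr_coord_le i l) sq) (archi_boundP (exprn_ge0 4 (ltW ke0))).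
move: (Num.bound _) => N hN.
have : ((i 0 l) ^+ 2)%:~R < (N%:Z)%:~R :> R by rewrite rmorphXn.
by rewrite ltr_int; nia.
Qed.

(* The (4d)^-1 in the Laplacian is half the weight of a step of the simple
   random walk: - laplacian G = delta reads G = P G + 2 delta. *)
Fixpoint green_iter n i : R :=
  if n is n'.+1 then
    (2 * d)%:R^-1 * (\sum_(j <- neighbors i) green_iter n' j) + 2 * (i == 0)%:R
  else 0.

Lemma green_iter_homo : forall n i, green_iter n i <= green_iter n.+1 i.
Proof.
elim=> [|n IH] i.
  by rewrite /= big1// mulr0 add0r mulr_ge0.
rewrite [green_iter n.+1 i]/= [green_iter n.+2 i]/= lerD2r ler_wpM2l ?invr_ge0//.
by apply: ler_sum => j _; exact: IH.
Qed.

Lemma green_iter_bounded : exists2 k : R, 0 < k &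
  forall n i, green_iter n i <= k * barrier i.
Proof.
have d0 : (0 < d)%N by exact: leq_trans d3.
have dd : 0 < (2 * d)%:R :> R by rewrite ltr0n muln_gt0.
set gap := (2 * d)%:R * barrier 0 - \sum_(j <- neighbors (0 : site d)) barrier j.
have gap0 : 0 < gap by rewrite subr_gt0 barrier_strict.
have k0 : 0 < 2 * (2 * d)%:R / gap by rewrite divr_gt0// mulr_gt0.
(* With this constant the defect at the origin, the constant times [gap] divided by 2 d, is exactly
   the source 2. *)
exists (2 * (2 * d)%:R / gap) => //.
elim=> [|n IH] i; first by rewrite mulr_ge0 ?ltW ?barrier_gt0.
apply: (@le_trans _ _ ((2 * d)%:R^-1 *
   (\sum_(j <- neighbors i) (2 * (2 * d)%:R / gap) * barrier j) + 2 * (i == 0)%:R)).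
  by rewrite /= lerD2r ler_wpM2l ?invr_ge0//; exact: ler_sum.
rewrite -mulr_sumr; have [->|i0] := eqVneq i 0.
  rewrite mulr1 le_eqVlt; apply/orP; left; apply/eqP.
  have -> : \sum_(j <- neighbors (0 : site d)) barrier j = (2 * d)%:R * barrier 0 - gap.
    by rewrite /gap; ring.
  by field; rewrite !gt_eqF//= ltr0n.
rewrite mulr0 addr0 mulrCA; apply: ler_wpM2l; first exact: ltW.
rewrite ler_pdivrMl//.
exact: barrier_superharmonic.
Qed.

Definition green0 i : R := limn (green_iter ^~ i).

Lemma green_iter_cvg i : green_iter n i @[n --> \oo] --> green0 i.
Proof.
apply: nondecreasing_is_cvgn.
  by apply/nondecreasing_seqP => n; exact: green_iter_homo.
have [k _ kb] := green_iter_bounded.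
by exists (k * barrier i) => _ [n _ <-].
Qed.

Lemma green_iter_le n i : green_iter n i <= green0 i.
Proof.
apply: nondecreasing_cvgn_le; last exact: green_iter_cvg.
by apply/nondecreasing_seqP => m; exact: green_iter_homo.
Qed.

Lemma green0_ge0 i : 0 <= green0 i.
Proof. exact: (green_iter_le 0). Qed.

Lemma green0_gt0 : 0 < green0 0.
Proof.
apply: lt_le_trans (green_iter_le 1 0).
by rewrite /= big1// mulr0 add0r eqxx mulr1.
Qed.

Lemma green0_laplacian i : - laplacian green0 i = (i == 0)%:R.
Proof.
have d0 : (0 < d)%N by exact: leq_trans d3.
have dd : (2 * d)%:R != 0 :> R by rewrite pnatr_eq0 muln_eq0 -lt0n d0.
have E : green0 i = (2 * d)%:R^-1 * (\sum_(j <- neighbors i) green0 j) + 2 * (i == 0)%:R.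
  have h1 : green_iter n.+1 i @[n --> \oo] --> green0 i.
    by rewrite (cvg_shiftS (green_iter ^~ i)); exact: green_iter_cvg.
  have h2 : green_iter n.+1 i @[n --> \oo] -->
      (2 * d)%:R^-1 * (\sum_(j <- neighbors i) green0 j) + 2 * (i == 0)%:R.
    apply: cvgD; last exact: cvg_cst.
    apply: cvgMr; rewrite -/green_iter; elim: (neighbors i) => [|j t IH].
      by rewrite big_nil; under eq_cvg do rewrite big_nil; exact: cvg_cst.
    rewrite big_cons; under eq_cvg do rewrite big_cons.
    by apply: cvgD => //; exact: green_iter_cvg.
  exact: cvg_unique h1 h2.
have S : \sum_(j <- neighbors i) green0 j = (2 * d)%:R * (green0 i - 2 * (i == 0)%:R).
  by rewrite [X in X - _]E addrK mulVKf.
rewrite /laplacian sumrB S big_const_seq count_predT size_neighbors iter_addr_0.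
rewrite -mulr_natl natrM; field; rewrite pnatr_eq0; lia.
Qed.

Lemma green0_vanishes : vanishes_at_infinity green0.
Proof.
have [k k0 kb] := green_iter_bounded.
move=> e e0; apply: sub_finite_set (barrier_vanishes k0 e0) => i /= /le_trans; apply.
have kb0 : 0 <= k * barrier i by exact: ltW (mulr_gt0 k0 (barrier_gt0 i)).
rewrite !ger0_norm ?green0_ge0//.
have /cvg_lim <- // := @green_iter_cvg i.
apply: limr_le; first by apply: cvgP; exact: green_iter_cvg.
by apply: nearW => n; exact: kb.
Qed.

Definition green i j : R := green0 (i - j).

Lemma green_inverse : is_inverse_neg_laplacian green.
Proof.
move=> j; split=> [i|e e0].
  by rewrite laplacian_shift green0_laplacian subr_eq0.
have := finite_image (fun i => i + j) (green0_vanishes e0).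
apply: sub_finite_set => i /= h; exists (i - j) => //; by rewrite subrK.
Qed.

Lemma green_unique G : is_inverse_neg_laplacian G -> green = G.
Proof.
move=> Ginv; apply/funext => i; apply/funext => j.
have [lG vG] := Ginv j; have [lg vg] := green_inverse j.
have d0 : (0 < d)%N by exact: leq_trans d3.
have E : green ^~ j = G ^~ j.
  by apply: harmonic_eq => // x; apply: oppr_inj; rewrite lg lG.
by rewrite -[LHS]/((green ^~ j) i) E.
Qed.

End green_function.

(** * Integrals over powers of a measure *)

Section measure_tools.
Local Open Scope ereal_scope.

Section translation.
Context {R : realType}.
Notation RT := (measurableTypeR R).
Local Notation mu := lebesgue_measure.

Lemma ge0_integral_translation (a : R) (f : R -> \bar R) :
  measurable_fun [set: R] f -> (forall x, 0 <= f x) ->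
  \int[mu]_x f (x + a)%R = \int[mu]_x f x.
Proof.
move=> mf f0.
have ma : measurable_fun [set: R] (fun x : RT => x + a : RT)%R by exact: measurable_funD.
transitivity (\int[pushforward mu (fun x : RT => (x + a)%R : RT)]_x f x).
  by rewrite ge0_integral_pushforward.
apply: eq_measure_integral => //= A mA _; apply/esym/lebesgue_measure_unique => //.
move=> _ [[u v]] _ <- /=.
transitivity (mu `](u - a)%R, (v - a)%R]%classic); last first.
  by congr (mu _); apply/seteqP; split => x; rewrite /= !in_itv/= ltrBlDr lerBrDr.
by rewrite !lebesgue_measure_itv/= !lte_fin ltrD2r -!EFinD opprB addrA subrK.
Qed.

Lemma ge0_integral_opp (f : R -> \bar R) :
  measurable_fun [set: R] f -> (forall x, 0 <= f x) ->
  \int[mu]_x f (- x)%R = \int[mu]_x f x.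
Proof.
move=> mf f0.
transitivity (\int[pushforward mu (-%R : RT -> RT)]_x f x).
  by rewrite ge0_integral_pushforward.
by apply: eq_measure_integral => //= A mA _; exact: lebesgue_measureN.
Qed.

(** Dominated by two exponential densities, one per half-line, which overlap only at 0. *)
Lemma integral_expR_opp_norm (a : R) : \int[mu]_x (expR (- `|x - a|))%:E <= 2%:E.
Proof.
have mexp : measurable_fun [set: R] (fun x : RT => (expR (- `|x|))%:E).
  apply/measurable_EFinP; apply: measurableT_comp => //.
  exact: measurableT_comp.
rewrite (@ge0_integral_translation (- a) (fun x : RT => (expR (- `|x|))%:E))//.
have mpdf := @measurable_exponential_pdf R 1%R.
apply: (@le_trans _ _ (\int[mu]_x ((exponential_pdf 1 x)%:E + (exponential_pdf 1 (- x))%:E))).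
  apply: ge0_le_integral => //.
  - apply: emeasurable_funD; apply/measurable_EFinP => //.
    exact: (measurableT_comp mpdf).
  - move=> x _; rewrite -EFinD lee_fin.
    have [x0|x0] := leP 0%R x.
      rewrite (exponential_pdfE _ x0) ger0_norm// mul1r mulN1r lerDl.
      exact: exponential_pdf_ge0.
    have Nx0 : (0 <= - x)%R by rewrite oppr_ge0 ltW.
    rewrite (exponential_pdfE _ Nx0) ltr0_norm// mul1r mulN1r lerDr.
    exact: exponential_pdf_ge0.
rewrite ge0_integralD//; last 4 first.
- by move=> x _; rewrite lee_fin exponential_pdf_ge0.
- exact/measurable_EFinP.
- by move=> x _; rewrite lee_fin exponential_pdf_ge0.
- by apply/measurable_EFinP; exact: (measurableT_comp mpdf).
rewrite (@ge0_integral_opp (fun x : RT => (exponential_pdf 1 x)%:E)); last 2 first.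
- exact/measurable_EFinP.
- by move=> x; rewrite lee_fin exponential_pdf_ge0.
by rewrite integral_exponential_pdf.
Qed.

End translation.

Section power_measure_integrals.
Context {R : realType}.
Notation RT := (measurableTypeR R).
Implicit Types m : {sigma_finite_measure set RT -> \bar R}.

Lemma ge0_integral_power_measureS m n (f : n.+1.-tuple RT -> \bar R) :
  measurable_fun [set: n.+1.-tuple RT] f -> (forall t, 0 <= f t) ->
  \int[power_measure m n.+1]_t f t =
  \int[m]_x \int[power_measure m n]_t f (tcons (x, t)).
Proof.
move=> mf f0; rewrite /= ge0_integral_pushforward//.
rewrite preimage_setT (fubini_tonelli1 (m1 := m) (m2 := power_measure m n) (f \o @tcons R n))//.
- exact: measurableT_comp.
- by move=> p; exact: f0.
Qed.

Lemma ge0_integral_power_measure0 m (f : 0.-tuple RT -> \bar R) :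
  measurable_fun [set: 0.-tuple RT] f -> 
  \int[power_measure m 0]_t f t = f [tuple].
Proof. by move=> mf; rewrite /= integral_dirac// diracE mem_set// mul1e. Qed.

Lemma tins_subproof n k (x : R) (t : n.-tuple R) : (k <= n)%N ->
  size (take k t ++ x :: drop k t) == n.+1.
Proof.
move=> kn; rewrite size_cat/= size_drop size_takel ?size_tuple//.
by rewrite addnS subnKC.
Qed.

(** The recursion of [power_measure] exposes only the first factor; insertion at an arbitrary
    position allows any site of the box to be integrated out first. *)
Definition tins n k (kn : (k <= n)%N) (p : RT * n.-tuple RT) : n.+1.-tuple RT :=
  Tuple (tins_subproof p.1 p.2 kn).

Lemma measurable_tins n k (kn : (k <= n)%N) : measurable_fun setT (tins kn).
Proof.
apply/measurable_fun_tnthP => i.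
have [ik|ik|ik] := ltngtP i k.
- have iin : (i < n)%N by exact: leq_trans kn.
  rewrite (_ : _ \o _ = @tnth n RT ^~ (Ordinal iin) \o snd).
    by apply: measurableT_comp => //; exact: measurable_tnth.
  apply/funext => -[x t] /=; rewrite !(tnth_nth x)/= nth_cat.
  by rewrite size_takel ?size_tuple// ik nth_take.
- have iin : (i.-1 < n)%N by have := ltn_ord i; case: (nat_of_ord i) ik.
  rewrite (_ : _ \o _ = @tnth n RT ^~ (Ordinal iin) \o snd).
    by apply: measurableT_comp => //; exact: measurable_tnth.
  apply/funext => -[x t] /=; rewrite !(tnth_nth x)/= nth_cat.
  rewrite size_takel ?size_tuple// ltnNge ltnW//= subnE -subnE.
  case: (nat_of_ord i) ik {iin} => // i' ki.
  by rewrite subSn//= nth_drop subnKC.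
- rewrite (_ : _ \o _ = fst)//.
  apply/funext => -[x t] /=; rewrite !(tnth_nth x)/= nth_cat.
  by rewrite size_takel ?size_tuple// ik ltnn subnn.
Qed.

(** Induction on the position: peel off the first coordinate, insert into the tail, then exchange
    the two outer integrals by Tonelli. *)
Lemma ge0_integral_tins m n k (kn : (k <= n)%N) (f : n.+1.-tuple RT -> \bar R) :
  measurable_fun [set: n.+1.-tuple RT] f -> (forall t, 0 <= f t) ->
  \int[power_measure m n.+1]_t f t =
  \int[m]_x \int[power_measure m n]_t f (tins kn (x, t)).
Proof.
elim: k n kn f => [|k IH] n kn f mf f0.
  rewrite ge0_integral_power_measureS//; apply: eq_integral => x _.
  apply: eq_integral => t _; congr f; apply: val_inj => /=.
  by rewrite take0 drop0.
case: n kn f mf f0 => // n kn f mf f0; have kn' : (k <= n)%N by [].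
have mc : measurable_fun [set: RT * n.+1.-tuple RT] (@tcons R n.+1) by [].
rewrite ge0_integral_power_measureS//.
transitivity (\int[m]_y \int[m]_x \int[power_measure m n]_t
    f (tcons (y, tins kn' (x, t)))).
  apply: eq_integral => y _; rewrite (IH _ kn')//.
  by apply: measurableT_comp => //; apply: measurable_cons => //; exact: measurable_id.
pose g (p : (RT * RT) * n.-tuple RT) := f (tcons (p.1.1, tins kn' (p.1.2, p.2))).
have mg : measurable_fun setT g.
  apply: measurableT_comp => //; apply: measurable_cons.
    exact: (measurableT_comp measurable_fst measurable_fst).
  apply: (measurableT_comp (@measurable_tins n k kn')).
  apply: measurable_fun_pair => //=.
  exact: (measurableT_comp measurable_snd measurable_fst).
rewrite (fubini_tonelli (fun p : RT * RT => \int[power_measure m n]_t g (p, t)))//; last 2 first.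
- by apply: (measurable_fun_fubini_tonelli_F (m2 := power_measure m n) g) => // p; exact: f0.
- by move=> p; apply: integral_ge0 => t _; exact: f0.
apply: eq_integral => x _; rewrite ge0_integral_power_measureS//.
  apply: eq_integral => y _; apply: eq_integral => t _; rewrite /g; congr f.
  by apply: val_inj.
by apply: measurableT_comp => //; apply: measurableT_comp; [exact: measurable_tins|exact: measurable_fun_pair].
Qed.

End power_measure_integrals.
End measure_tools.

(** * Measures given by a density, and Jensen's inequality *)

Section density.
Local Open Scope ereal_scope.
Context d (T : measurableType d) (R : realType).
Variables (m : {measure set T -> \bar R}) (w : T -> R).
Hypotheses (mw : measurable_fun setT w) (w0 : forall x, (0 <= w x)%R).

Definition density (A : set T) : \bar R := \int[m]_(x in A) (w x)%:E.

Let density0 : density set0 = 0. Proof. exact: integral_set0. Qed.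

Let density_ge0 A : 0 <= density A.
Proof. by apply: integral_ge0 => x _; rewrite lee_fin. Qed.

Let density_sigma_additive : semi_sigma_additive density.
Proof.
move=> F mF tF mUF; rewrite /density; apply: cvg_toP.
  apply: ereal_nondecreasing_is_cvgn => k n kn.
  by apply: lee_sum_nneg_natr => // i _ _; exact: density_ge0.
rewrite ge0_integral_bigcup//; first exact/measurable_funTS/measurable_EFinP.
by move=> x _; rewrite lee_fin.
Qed.

Let density_measure : {measure set T -> \bar R} :=
  HB.pack density (isMeasure.Build _ _ _ density density0 density_ge0 density_sigma_additive).

Import HBNNSimple.

Let integral_density_nnsfun (h : {nnsfun T >-> R}) :
  \int[density]_x (h x)%:E = \int[m]_x ((h x)%:E * (w x)%:E).
Proof.
have mwE : measurable_fun setT (EFin \o w) by exact/measurable_EFinP.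
transitivity (\int[density_measure]_x (h x)%:E) => //.
rewrite integralT_nnsfun sintegralE.
transitivity (\int[m]_x (\sum_(y \in range h)
    (y * \1_(h @^-1` [set y]) x)%:E * (w x)%:E)); last first.
  apply: eq_integral => x _; rewrite -ge0_mule_fsuml; last first.
    by move=> y; exact: nnfun_muleindic_ge0.
  by rewrite fsumEFin// -(fimfunE _ x).
rewrite ge0_integral_fsum//; last 2 first.
- move=> y; apply: emeasurable_funM => //.
  by apply/measurable_EFinP; exact: measurable_funM.
- by move=> y x _; rewrite mule_ge0 ?nnfun_muleindic_ge0// lee_fin.
apply: eq_fsbigr => y /set_mem[t _ <-].
under [RHS]eq_integral do rewrite EFinM -muleA.
rewrite ge0_integralZl//.
- congr (_ * _); rewrite /= /density integral_mkcond.
  apply: eq_integral => x _; rewrite patchE indicE.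
  by case: ifP => /= _; rewrite ?mul1e ?mul0e.
- by apply: emeasurable_funM => //; exact/measurable_EFinP.
- by move=> x _; rewrite mule_ge0 ?lee_fin.
- by rewrite lee_fin.
Qed.

Lemma ge0_integral_density (f : T -> \bar R) :
  measurable_fun setT f -> (forall x, 0 <= f x) ->
  \int[density]_x f x = \int[m]_x (f x * (w x)%:E).
Proof.
move=> mf f0; pose h := nnsfun_approx measurableT mf.
have hf x : EFin \o h ^~ x @ \oo --> f x by exact: cvg_nnsfun_approx.
have fE x : f x = limn (fun n => (h n x)%:E) by apply/esym/cvg_lim => //; exact: hf.
transitivity (limn (fun n => \int[density_measure]_x (h n x)%:E)).
  rewrite -[LHS]/(\int[density_measure]_x f x).
  rewrite -monotone_convergence//.
  - by apply: eq_integral => x _; exact: fE.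
  - by move=> n; exact/measurable_EFinP.
  - by move=> n x _; rewrite lee_fin.
  - by move=> x _ a b ab; rewrite lee_fin; exact/lefP/nd_nnsfun_approx.
transitivity (limn (fun n => \int[m]_x ((h n x)%:E * (w x)%:E))).
  have -> // : (fun n => \int[density_measure]_x (h n x)%:E) =
      (fun n => \int[m]_x ((h n x)%:E * (w x)%:E)).
  by apply/funext => n; exact: integral_density_nnsfun.
rewrite -monotone_convergence//.
- apply: eq_integral => x _; apply/cvg_lim; first exact: ereal_hausdorff.
  apply: cvgeZr; [by []|exact: (hf x)].
- by move=> n; apply: emeasurable_funM; exact/measurable_EFinP.
- by move=> n x _; rewrite mule_ge0 ?lee_fin.
- move=> x _ a b ab; rewrite lee_wpmul2r ?lee_fin//.
  exact/lefP/nd_nnsfun_approx.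
Qed.

Lemma ge0_integral_scaled_density (k : R) (f : T -> \bar R) : (0 <= k)%R ->
  measurable_fun setT f -> (forall x, 0 <= f x) ->
  \int[fun A => k%:E * density A]_x f x = k%:E * \int[m]_x (f x * (w x)%:E).
Proof.
move=> k0 mf f0.
have -> : (fun A => k%:E * density A) = mscale (NngNum k0) density_measure by [].
by rewrite ge0_integral_mscale// ge0_integral_density.
Qed.

(** Stated for this set function because [gibbs], which is not packaged as a measure, unfolds to it.
    As [w] is nonnegative, taking positive and negative parts commutes with multiplication by
    [w]. *)
Lemma integral_scaled_density (k : R) (f : T -> R) : (0 <= k)%R ->
  measurable_fun setT f -> m.-integrable setT (fun x => (f x * w x)%:E) ->
  \int[fun A => k%:E * density A]_x (f x)%:E = k%:E * \int[m]_x (f x * w x)%:E.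
Proof.
move=> k0 mf ifw.
have mfE : measurable_fun setT (EFin \o f) by exact/measurable_EFinP.
pose nu : {measure set T -> \bar R} := mscale (NngNum k0) density_measure.
have nuE (g : T -> \bar R) : measurable_fun setT g -> (forall x, 0 <= g x) ->
    \int[nu]_x g x = k%:E * \int[m]_x (g x * (w x)%:E).
  exact: ge0_integral_scaled_density.
transitivity (\int[nu]_x (EFin \o f) x) => //.
rewrite [LHS]integralE nuE//; last exact: measurable_funepos.
rewrite nuE//; last exact: measurable_funeneg.
rewrite [in RHS]integralE.
have -> : \int[m]_x ((EFin \o f)^\+ x * (w x)%:E) = \int[m]_x (fun x0 : T => (f x0 * w x0)%:E)^\+ x.
  apply: eq_integral => x _; rewrite !funeposE /= -EFin_max -EFinM -EFin_max; congr EFin.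
  by rewrite maxr_pMl// mul0r.
have -> : \int[m]_x ((EFin \o f)^\- x * (w x)%:E) = \int[m]_x (fun x0 : T => (f x0 * w x0)%:E)^\- x.
  apply: eq_integral => x _; rewrite !funenegE /= -EFin_max -EFinM -EFin_max; congr EFin.
  by rewrite maxr_pMl// mul0r mulNr.
have nfin : \int[m]_x (fun x0 : T => (f x0 * w x0)%:E)^\- x \is a fin_num.
  by apply: integrable_neg_fin_num.
apply/esym/muleBr => //; apply: fin_num_adde_defl; rewrite fin_numN.
exact: nfin.
Qed.

End density.

(** Jensen's inequality for the law with density exp(f) / z, by the tangent of the exponential at
    the mean s / z: exp(g) >= exp(f) exp(s / z) (1 + g - f - s / z). When exp(g) has infinite
    integral the bound is trivial. *)
Lemma expR_integral_jensen d (T : measurableType d) (R : realType)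
    (m : {measure set T -> \bar R}) (f g : T -> R) (z s : R) :
  measurable_fun setT f -> measurable_fun setT g ->
  (\int[m]_x (expR (f x))%:E = z%:E)%E -> 0 < z ->
  m.-integrable setT (fun x => ((g x - f x) * expR (f x))%:E) ->
  (\int[m]_x ((g x - f x) * expR (f x))%:E = s%:E)%E ->
  ((z * expR (s / z))%:E <= \int[m]_x (expR (g x))%:E)%E.
Proof.
move=> mf mg zE z0 ifg sE.
have mef : measurable_fun setT (fun x => (expR (f x))%:E).
  by apply/measurable_EFinP; exact: measurableT_comp.
have meg : measurable_fun setT (fun x => (expR (g x))%:E).
  by apply/measurable_EFinP; exact: measurableT_comp.
have ief : m.-integrable setT (fun x => (expR (f x))%:E).
  apply/integrableP; split => //.
  by under eq_integral do rewrite gee0_abs ?lee_fin ?expR_ge0//; rewrite zE ltry.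
pose a := s / z.
pose F x := expR a * (1 - a) * expR (f x).
pose G x := expR a * ((g x - f x) * expR (f x)).
have iF : m.-integrable setT (EFin \o F).
  exact: (integrableZl measurableT (expR a * (1 - a)) ief).
have iG : m.-integrable setT (EFin \o G).
  exact: (integrableZl measurableT (expR a) ifg).
have FGE : (\int[m]_x ((F x)%:E + (G x)%:E) = (z * expR (s / z))%:E)%E.
  rewrite integralD//.
  have -> : (\int[m]_x (F x)%:E = (expR a * (1 - a) * z)%:E)%E.
    by rewrite EFinM -zE -integralZl//; apply: eq_integral => x _; rewrite -EFinM.
  have -> : (\int[m]_x (G x)%:E = (expR a * s)%:E)%E.
    by rewrite EFinM -sE -integralZl//; apply: eq_integral => x _; rewrite -EFinM.
  by rewrite -EFinD; congr EFin; rewrite /a; field; rewrite gt_eqF.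
have [ieg|] := boolP (\int[m]_x (expR (g x))%:E < +oo)%E; last first.
  by rewrite -leNgt leye_eq => /eqP ->; rewrite leey.
rewrite -FGE; apply: le_integral => //.
- exact: integrableD.
- apply/integrableP; split => //.
  by under eq_integral do rewrite gee0_abs ?lee_fin ?expR_ge0//.
move=> x _; rewrite -EFinD lee_fin /F /G.
have -> : expR a * (1 - a) * expR (f x) + expR a * ((g x - f x) * expR (f x)) =
   expR (f x) * expR a * (1 + (g x - f x - a)) by ring.
have -> : expR (g x) = expR (f x) * expR a * expR (g x - f x - a).
  by rewrite -!expRD; congr expR; ring.
by rewrite ler_wpM2l ?mulr_ge0 ?expR_ge0// expR_ge1Dx.
Qed.

(** * Integrating the sites of a box one by one *)

Section iterated_bounds.
Context {R : realType}.
Notation RT := (measurableTypeR R).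

(** Generalises [spin] to an arbitrary list of sites, so that an induction can delete sites one at a
    time. A site off the list reads 0, which is the boundary condition. *)
Definition coord {I : eqType} (s : seq I) (t : seq R) (i : I) : R :=
  nth (0 : R) t (index i s).

Lemma measurable_nth n k :
  measurable_fun [set: n.-tuple RT] (fun t : n.-tuple RT => nth (0 : R) t k).
Proof.
have [kn|nk] := ltnP k n.
  rewrite (_ : (fun _ => _) = @tnth n RT ^~ (Ordinal kn)); first exact: measurable_tnth.
  by apply/funext => t; rewrite (tnth_nth (0 : R)).
rewrite (_ : (fun _ => _) = cst (0 : R)); first exact: measurable_cst.
by apply/funext => t; rewrite nth_default// size_tuple.
Qed.

Lemma measurable_coord (I : eqType) (s : seq I) n i :
  measurable_fun [set: n.-tuple RT] (fun t : n.-tuple RT => coord s t i).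
Proof. exact: measurable_nth. Qed.

Lemma coord_insert (I : eqType) (s1 s2 : seq I) (x : R) (t : seq R) i j :
  uniq (s1 ++ i :: s2) -> size t = size (s1 ++ s2) ->
  coord (s1 ++ i :: s2) (take (size s1) t ++ x :: drop (size s1) t) j =
  if j == i then x else coord (s1 ++ s2) t j.
Proof.
rewrite cat_uniq /= => /and3P[_ + _] st; rewrite negb_or => /andP[is1 _].
have s1t : (size s1 <= size t)%N by rewrite st size_cat leq_addr.
rewrite /coord nth_cat size_takel// !index_cat.
have [->|ji] := eqVneq j i.
  by rewrite (negbTE is1)/= eqxx addn0 ltnn subnn.
have [js1|js1] := boolP (j \in s1).
  by rewrite index_mem js1 nth_take// index_mem.
rewrite /= [i == j]eq_sym (negbTE ji) ltnNge leq_addr/= addKn/=.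
by rewrite nth_drop.
Qed.

Lemma seq_argmax (I : eqType) (h : I -> int) (s : seq I) : (0 < size s)%N ->
  exists2 i, i \in s & forall j, j \in s -> h j <= h i.
Proof.
elim: s => // a [|b s] IH _.
  by exists a; rewrite ?mem_head// => j; rewrite inE => /eqP ->.
have [//|i si imax] := IH; have [ai|ia] := leP (h a) (h i).
  exists i; first by rewrite inE si orbT.
  by move=> j; rewrite inE => /predU1P[->//|/imax].
exists a; first exact: mem_head.
move=> j; rewrite inE => /predU1P[->//|/imax/le_trans]; apply; exact: ltW.
Qed.

(* A site that is maximal for the height is the parent of no other site, so it
   can be integrated out first, at cost c, whatever its position in s. *)
Lemma integral_prod_kernel_le (I : eqType) (p : I -> I) (h : I -> int)
    (m : {sigma_finite_measure set RT -> \bar R}) (K : R -> R) (c : R) :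
  (forall i, h (p i) < h i) ->
  measurable_fun [set: R] K -> (forall x, 0 <= K x) -> 0 <= c ->
  (forall a, (\int[m]_x (K (x - a))%:E <= c%:E)%E) ->
  forall n (s : seq I), size s = n -> uniq s ->
  (\int[power_measure m n]_t
     (\prod_(i <- s) K (coord s t i - coord s t (p i)))%:E <= (c ^+ n)%:E)%E.
Proof.
move=> hp mK K0 c0 Kc.
have mprod n (s r : seq I) : measurable_fun [set: n.-tuple RT]
    (fun t : n.-tuple RT => (\prod_(i <- r) K (coord s t i - coord s t (p i)))%:E).
  apply/measurable_EFinP; apply: measurable_prod => i _.
  apply: measurableT_comp => //; apply: measurable_funB; exact: measurable_coord.
have prod0 (s r : seq I) t : 0 <= \prod_(i <- r) K (coord s t i - coord s t (p i)).
  by apply: prodr_ge0.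
elim=> [s /size0nil -> _|n IH s sn us].
  rewrite ge0_integral_power_measure0//.
  by rewrite big_nil.
have [i si imax] : exists2 i, i \in s & forall j, j \in s -> h j <= h i.
  by apply: seq_argmax; rewrite sn.
move: sn us imax; case/path.splitPr: si => s1 s2 sn us imax.
have sn' : size (s1 ++ s2) = n by move: sn; rewrite !size_cat/= addnS => -[].
have us' : uniq (s1 ++ s2).
  by move: us; rewrite -cat1s uniq_catCA cat1s /= => /andP[].
have kn : (size s1 <= n)%N by rewrite -sn' size_cat leq_addr.
pose S := s1 ++ i :: s2.
pose f (t : n.+1.-tuple RT) : R := \prod_(j <- S) K (coord S t j - coord S t (p j)).
have mf : measurable_fun [set: n.+1.-tuple RT] (EFin \o f) by exact: mprod.
have pi_ne j : j \in S -> p j != i.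
  move=> jS; apply/eqP => pji; have := hp j; rewrite pji.
  by rewrite ltNge imax.
have fE (t : n.-tuple RT) x : f (tins kn (x, t)) =
    K (x - coord (s1 ++ s2) t (p i)) *
    \prod_(j <- s1 ++ s2) K (coord (s1 ++ s2) t j - coord (s1 ++ s2) t (p j)).
  have C j : coord S (tins kn (x, t)) j = if j == i then x else coord (s1 ++ s2) t j.
    by rewrite /= coord_insert// size_tuple.
  have iS : i \in S by rewrite mem_cat mem_head orbT.
  rewrite /f /S (perm_big (i :: (s1 ++ s2)))/=; last by rewrite -cat1s perm_catCA.
  rewrite big_cons; congr (_ * _).
    by rewrite !C eqxx (negbTE (pi_ne _ iS)).
  apply: eq_big_seq => j js; have jS : j \in S.
    by move: js; rewrite !mem_cat inE => /orP[]->//; rewrite !orbT.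
  rewrite !C (negbTE (pi_ne _ jS)); case: eqVneq => // ji.
  by move: us; rewrite -cat1s uniq_catCA cat1s /= -ji js.
rewrite [leLHS](ge0_integral_tins m kn (f := EFin \o f))//; last first.
  by move=> t; rewrite lee_fin prod0.
rewrite (fubini_tonelli (m1 := m) (m2 := power_measure m n)
  (fun q => (EFin \o f) (tins kn q)))//; last 2 first.
- by apply: measurableT_comp => //; exact: measurable_tins.
- by move=> q; rewrite lee_fin prod0.
apply: (@le_trans _ _ (\int[power_measure m n]_t (c%:E * (\prod_(j <- s1 ++ s2)
     K (coord (s1 ++ s2) t j - coord (s1 ++ s2) t (p j)))%:E))%E); last first.
  rewrite ge0_integralZl ?lee_fin//; [|exact: mprod|by move=> t _; rewrite lee_fin prod0].
  by rewrite exprS EFinM lee_wpmul2l ?lee_fin// IH.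
have mKx a : measurable_fun [set: R] (fun x => (K (x - a))%:E).
  apply/measurable_EFinP; apply: measurableT_comp => //.
  by apply: measurable_funB.
apply: ge0_le_integral => //.
- by move=> t _; apply: integral_ge0 => x _; rewrite lee_fin prod0.
- apply: (measurable_fun_fubini_tonelli_G (m1 := m) (fun q => (EFin \o f) (tins kn q))).
    by apply: measurableT_comp => //; exact: measurable_tins.
  by move=> q; rewrite lee_fin prod0.
- by apply: emeasurable_funM => //; exact: mprod.
- move=> t _; under eq_integral do rewrite /= fE EFinM.
  rewrite ge0_integralZr ?lee_fin//; first by rewrite lee_wpmul2r ?lee_fin.
  - exact: mKx.
  - by move=> x _; rewrite lee_fin.
Qed.

(** The uniform law is kept as a measure on the whole line. Clipping is the identity on the unit
    interval and makes the bounds for heights in [0, 1] hold everywhere rather than almost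
    everywhere. *)
Definition clip (x : R) : R := Num.max 0 (Num.min 1 x).

Lemma clip_ge0 x : 0 <= clip x. Proof. by rewrite le_max lexx. Qed.

Lemma clip_le1 x : clip x <= 1. Proof. by rewrite ge_max ler01 ge_min lexx. Qed.

Lemma clip_id x : 0 <= x <= 1 -> clip x = x.
Proof. by move=> /andP[x0 x1]; rewrite /clip min_r// max_r. Qed.

Lemma measurable_clip : measurable_fun [set: R] clip.
Proof.
apply: measurable_maxr => //; apply: measurable_minr => //.
Qed.

Definition unit_uniform : set RT -> \bar R := uniform_prob (@ltr01 R).
HB.instance Definition _ := Probability.on unit_uniform.

Definition shift_clip n (u : nat -> R) (t : n.-tuple RT) : n.-tuple RT :=
  [tuple clip (tnth t i) + u i | i < n].

Lemma measurable_shift_clip n u : measurable_fun setT (@shift_clip n u).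
Proof.
apply/measurable_fun_tnthP => i.
rewrite (_ : _ \o _ = fun t : n.-tuple RT => clip (tnth t i) + u i); last first.
  by apply/funext => t /=; rewrite tnth_mktuple.
apply: measurable_funD => //; apply: measurableT_comp; first exact: measurable_clip.
exact: measurable_tnth.
Qed.

(** The uniform density is at most 1, so after a translation the law is dominated by Lebesgue
    measure, hence by [m]: this is how the atoms are dropped. *)
Lemma integral_clip_le (m : {measure set RT -> \bar R}) (a : R) (g : R -> \bar R) :
  (forall A, measurable A -> lebesgue_measure A <= m A)%E ->
  measurable_fun [set: R] g -> (forall x, 0 <= g x)%E ->
  (\int[unit_uniform]_x g (clip x + a)%R <= \int[m]_x g x)%E.
Proof.
move=> lem mg g0.
have mga : measurable_fun [set: R] (fun x : R => g (x + a)).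
  by apply: measurableT_comp => //; exact: measurable_funD.
rewrite integral_uniform//; last first.
  apply: (measurableT_comp mg); apply: measurable_funD => //; exact: measurable_clip.
rewrite subr0 invr1 mul1e.
apply: (@le_trans _ _ (\int[lebesgue_measure]_x g x)%E).
  rewrite -(ge0_integral_translation a mg g0).
  rewrite (eq_integral (fun x : RT => g (x + a))); last first.
    by move=> x; rewrite inE/= in_itv/= => /clip_id ->.
  exact: ge0_subset_integral.
by apply: ge0_le_measure_integral => // A mA _; exact: lem.
Qed.

Lemma integral_shift_clip_le (m : {sigma_finite_measure set RT -> \bar R}) n
    (u : nat -> R) (g : n.-tuple RT -> \bar R) :
  (forall A, measurable A -> lebesgue_measure A <= m A)%E ->
  measurable_fun [set: n.-tuple RT] g -> (forall x, 0 <= g x)%E ->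
  (\int[power_measure unit_uniform n]_t g (shift_clip u t) <=
   \int[power_measure m n]_t g t)%E.
Proof.
move=> lem; elim: n u g => [|n IH] u g mg g0.
  rewrite !ge0_integral_power_measure0//; last first.
    by apply: measurableT_comp => //; exact: measurable_shift_clip.
  by rewrite (_ : shift_clip u _ = [tuple])// [LHS]tuple0.
have mgs : measurable_fun setT (g \o @shift_clip n.+1 u).
  by apply: measurableT_comp => //; exact: measurable_shift_clip.
have mgc : measurable_fun [set: RT * n.-tuple RT] (g \o @tcons R n).
  exact: measurableT_comp.
rewrite (ge0_integral_power_measureS _ mgs)//; last by move=> t; exact: g0.
rewrite ge0_integral_power_measureS//.
have E x (t : n.-tuple RT) : shift_clip u (tcons (x, t)) =
    tcons (clip x + u 0%N, shift_clip (u \o S) t) :> n.+1.-tuple RT.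
  apply: eq_from_tnth => i; rewrite tnth_mktuple.
  case: (unliftP ord0 i) => [j ->|->].
    by rewrite !tnthS/= tnth_mktuple.
  by rewrite !tnth0.
pose F (x : RT) := (\int[power_measure m n]_t g (tcons (x, t)))%E.
have mF : measurable_fun [set: RT] F.
  apply: (measurable_fun_fubini_tonelli_F (m2 := power_measure m n) (g \o @tcons R n)) => //.
  by move=> q; exact: g0.
have F0 x : (0 <= F x)%E by apply: integral_ge0 => t _; exact: g0.
apply: (@le_trans _ _ (\int[unit_uniform]_x F (clip x + u 0%N)%R)%E); last first.
  exact: integral_clip_le.
apply: ge0_le_integral => //.
- by move=> x _; apply: integral_ge0 => t _; exact: g0.
- apply: (measurable_fun_fubini_tonelli_F (m2 := power_measure unit_uniform n)
    ((g \o @shift_clip n.+1 u) \o @tcons R n)).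
    exact: measurableT_comp.
  by move=> q; exact: g0.
- apply: measurableT_comp => //; apply: measurable_funD => //; exact: measurable_clip.
- move=> x _; under eq_integral do rewrite /= E.
  apply: (IH (u \o S) (fun t => g (tcons (clip x + u 0%N, t)))) => //.
  by apply: measurableT_comp => //; apply: measurable_cons => //; exact: measurable_id.
Qed.

Lemma power_measure_setT (m : {sigma_finite_measure set RT -> \bar R}) n :
  (m setT = 1 -> power_measure m n setT = 1)%E.
Proof.
move=> m1; elim: n => [|n IH]; first by rewrite /= diracT.
rewrite -[LHS]mul1e -(@integral_cst _ _ _ (power_measure m n.+1) setT)//.
rewrite ge0_integral_power_measureS//.
transitivity (\int[m]_x cst 1%E x)%E; last by rewrite integral_cst// [X in (1 * X)%E]m1 mul1e.
apply: eq_integral => x _; transitivity (\int[power_measure m n]_t cst 1%E t)%E => //.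
by rewrite integral_cst// [X in (1 * X)%E]IH mul1e.
Qed.

End iterated_bounds.

(** * Energies of interface configurations *)

Section potential_theory.
Context {R : realType}.
Implicit Types f V : R -> R.

Lemma derivable_continuous f : (forall t, derivable f t 1) -> continuous f.
Proof. by move=> df t; apply: differentiable_continuous; exact/derivable1_diffP. Qed.

Lemma MVT_derivable f (a b : R) : (forall t, derivable f t 1) -> a < b ->
  exists2 c, a < c < b & f b - f a = derive1 f c * (b - a).
Proof.
move=> df ab.
have [||c cab E] := @MVT R f (derive1 f) a b ab.
- by move=> x _; rewrite derive1E; exact/derivableP.
- exact/continuous_subspaceT/derivable_continuous.
by exists c => //; move: cab; rewrite in_itv.
Qed.

(** The second derivative exists but need not be continuous, so the integral form of Taylor's
    remainder is not at hand. The mean value theorem is applied to [derive1 V], and then to V minus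
    the parabola (x - s)^2 / 2. *)
Lemma le_second_order V (s t : R) :
  (forall x, derivable V x 1) -> (forall x, derivable (derive1 V) x 1) ->
  (forall x, derive1 (derive1 V) x <= 1) ->
  V (s + t) <= V s + derive1 V s * t + t ^+ 2 / 2.
Proof.
move=> dV dV' V''1.
have V'lip x y : x < y -> derive1 V y - derive1 V x <= y - x.
  move=> xy; have [c _ ->] := MVT_derivable dV' xy.
  by rewrite ler_piMl ?V''1// subr_ge0 ltW.
pose g : R -> R := fun x : R => V x - 2^-1 * (x - s) ^+ 2.
have dg (x : R) : is_derive x (1 : R) g (derive1 V x - (x - s)).
  have d1 : is_derive x (1 : R) V (derive1 V x) by rewrite derive1E; exact/derivableP.
  rewrite /g; apply: is_derive_eq.
  by rewrite /GRing.scale /=; field.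
have g' (x : R) : derive1 g x = derive1 V x - (x - s) by rewrite derive1E; exact: derive.derive_val.
have gd (x : R) : derivable g x 1 by [].
have [t0|t0|->] := ltgtP t 0; last by rewrite !addr0 mulr0 addr0 expr0n mul0r addr0.
- have st : s + t < s by rewrite gtrDl.
  have [c /andP[c1 c2]] := MVT_derivable gd st.
  rewrite g' /g; have := V'lip _ _ c2; nra.
- have st : s < s + t by rewrite ltrDl.
  have [c /andP[c1 c2]] := MVT_derivable gd st.
  rewrite g' /g; have := V'lip _ _ c1; nra.
Qed.

Lemma continuous_bounded_itv f (r : R) : continuous f ->
  exists M, forall t, `|t| <= r -> `|f t| <= M.
Proof.
move=> cf; have [r0|r0] := ltP r 0.
  by exists 0 => t tr; have := le_trans (normr_ge0 t) tr; rewrite leNgt r0.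
have rr : - r <= r by lra.
have cn : {within `[- r, r], continuous (fun t => `|f t|)}.
  apply: continuous_subspaceT => t; apply: continuous_comp; first exact: cf.
  exact: norm_continuous.
have [c _ cmax] := EVT_max rr cn.
by exists `|f c| => t tr; apply: cmax; rewrite in_itv/= -ler_norml.
Qed.

Lemma superlinear_growth V : continuous V ->
  (1 < limf_einf (fun t : R => (ln (V t) / ln `|t|)%:E) (abs_infty R))%E ->
  forall H : R, exists2 C, 0 <= C & forall t, H * `|t| - C <= V t.
Proof.
move=> cV.
rewrite /limf_einf lteNr => /ereal_inf_lt[_ [A [M AM] <-]].
set b := ereal_sup _ => b1 H.
(* The liminf is minus an infimum of suprema of the negated ratio. A supremum [b] below -1 yields
   the exponent a = - b; it cannot be -oo, because the ratio is a real number at a point beyond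
   [M]. *)
have [a a1 aA] : exists2 a : R, 1 < a & forall t, M < `|t| -> a <= ln (V t) / ln `|t|.
  have bA t : M < `|t| -> (- (ln (V t) / ln `|t|)%:E <= b)%E.
    by move=> /AM At; apply: ereal_sup_ubound; exists t.
  case: b b1 bA => [r| |] r1 bA //.
  - exists (- r); first by move: r1; rewrite -EFinN lte_fin; lra.
    by move=> t /bA; rewrite -EFinN lee_fin; lra.
  - have tM : M < `| `|M| + 1|.
      by rewrite ger0_norm ?addr_ge0// (le_lt_trans (ler_norm M))// ltrDl.
    by have := bA _ tM; rewrite leeNy_eq.
pose H' := Num.max 1 H.
have H'1 : 1 <= H' by rewrite le_max lexx.
(* Beyond the second threshold (a - 1) ln|t| >= H', and then |t|^(a - 1) >= 1 + (a - 1) ln|t| >=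
   H'. *)
pose T0 := Num.max (`|M| + 1) (expR (H' / (a - 1))).
have big t : T0 < `|t| -> H * `|t| <= V t.
  rewrite gt_max => /andP[tM tE].
  have Mt : M < `|t| by apply: le_lt_trans tM; rewrite (le_trans (ler_norm M))// lerDl.
  have t1 : 1 < `|t| by apply: le_lt_trans tM; rewrite lerDr.
  have t0 : 0 < `|t| by exact: lt_trans t1.
  have lnt : 0 < ln `|t| by exact: ln_gt0.
  have := aA _ Mt; rewrite ler_pdivlMr// => lnV.
  (* [ln] is 0 at nonpositive arguments, so a positive ratio forces V t > 0. *)
  have V0 : 0 < V t.
    rewrite ltNge; apply/negP => /ln0 V0; move: lnV; rewrite V0; nra.
  apply: (@le_trans _ _ (expR (a * ln `|t|))); last first.
    by rewrite -[leRHS](@lnK _ (V t)) ?posrE// ler_expR.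
  rewrite (_ : a * ln `|t| = (a - 1) * ln `|t| + ln `|t|); last by ring.
  rewrite expRD lnK ?posrE// ler_pM2r//.
  apply: (@le_trans _ _ H'); first by rewrite le_max lexx orbT.
  apply: (@le_trans _ _ (1 + (a - 1) * ln `|t|)); last exact: expR_ge1Dx.
  have : H' / (a - 1) <= ln `|t|.
    by rewrite -[leLHS]expRK ler_ln ?posrE ?expR_gt0// ltW.
  rewrite ler_pdivrMr ?subr_gt0//; lra.
have [K KV] := continuous_bounded_itv T0 cV.
exists (`|H| * T0 + `|K|).
  by rewrite addr_ge0// mulr_ge0// le_max addr_ge0.
move=> t; have [tT|tT] := leP `|t| T0.
  have := KV _ tT; rewrite ler_norml => /andP[+ _].
  have := ler_norm K; have : H * `|t| <= `|H| * T0.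
    by rewrite (le_trans (ler_wpM2r (normr_ge0 t) (ler_norm H)))// ler_wpM2l.
  lra.
have := big _ tT; have : 0 <= `|H| * T0 by rewrite mulr_ge0// le_max addr_ge0.
have := normr_ge0 K; lra.
Qed.

End potential_theory.

(** * Energies as sums over edges *)

Section energy_theory.
Context {R : realType} {d : nat}.
Hypothesis d0 : (0 < d)%N.
Implicit Types (V W : R -> R) (Lam : {fset site d}) (f g u : site d -> R).

(** Common form of [energy], which is convertible to it, and of its derivative, so that linearity
    and monotonicity are proved once for both. *)
Definition edge_sum Lam (Phi : site d -> site d -> R) (Psi : site d -> R) : R :=
  (4 * d%:R)^-1 * (2^-1 * \sum_(i <- Lam) \sum_(j <- neighbors i | j \in Lam) Phi i j) +
  (4 * d%:R)^-1 * (\sum_(i <- Lam) \sum_(j <- neighbors i | j \notin Lam) Psi i).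

(** For [W] the derivative of V this is the derivative of the energy at [f] in the direction [u];
    for [W = id] it is the Dirichlet form. *)
Definition denergy W Lam f u : R :=
  edge_sum Lam (fun i j => W (f i - f j) * (u i - u j)) (fun i => W (f i) * u i).

Lemma edge_sumE Lam Phi Psi : edge_sum Lam Phi Psi =
  (4 * d%:R)^-1 * \sum_(i <- Lam) \sum_(j <- neighbors i)
     (if j \in Lam then 2^-1 * Phi i j else Psi i).
Proof.
rewrite /edge_sum -mulrDr; congr (_ * _); rewrite mulr_sumr -big_split/=.
apply: eq_bigr => i _; rewrite [RHS](bigID (fun j => j \in Lam))/=; congr (_ + _).
- by rewrite mulr_sumr; apply: eq_bigr => j ->.
- by apply: eq_bigr => j /negbTE ->.
Qed.

Lemma ge0_inv4d : 0 <= (4 * d%:R)^-1 :> R.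
Proof. by rewrite invr_ge0 mulr_ge0. Qed.

Lemma edge_sum_le Lam Phi Phi' Psi Psi' :
  (forall i j, Phi i j <= Phi' i j) -> (forall i, Psi i <= Psi' i) ->
  edge_sum Lam Phi Psi <= edge_sum Lam Phi' Psi'.
Proof.
move=> hPhi hPsi; rewrite !edge_sumE ler_wpM2l ?ge0_inv4d//.
apply: ler_sum => i _; apply: ler_sum => j _; case: ifP => // _.
by rewrite ler_wpM2l.
Qed.

Lemma edge_sumD Lam Phi Phi' Psi Psi' :
  edge_sum Lam (fun i j => Phi i j + Phi' i j) (fun i => Psi i + Psi' i) =
  edge_sum Lam Phi Psi + edge_sum Lam Phi' Psi'.
Proof.
rewrite !edge_sumE -mulrDr -big_split; congr (_ * _); apply: eq_bigr => i _ /=.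
by rewrite -big_split; apply: eq_bigr => j _ /=; case: ifP => // _; rewrite mulrDr.
Qed.

Lemma edge_sumZ Lam c Phi Psi :
  edge_sum Lam (fun i j => c * Phi i j) (fun i => c * Psi i) =
  c * edge_sum Lam Phi Psi.
Proof.
rewrite !edge_sumE mulrCA; congr (_ * _); rewrite mulr_sumr; apply: eq_bigr => i _.
rewrite mulr_sumr; apply: eq_bigr => j _; case: ifP => // _; ring.
Qed.

Lemma edge_sum_cst_le Lam (c : R) Phi Psi : 0 <= c ->
  (forall i j, Phi i j <= c) -> (forall i, Psi i <= c) ->
  edge_sum Lam Phi Psi <= c * #|` Lam|%:R.
Proof.
move=> c0 hPhi hPsi; apply: (@le_trans _ _ ((4 * d%:R)^-1 *
   \sum_(i <- Lam) \sum_(j <- neighbors i) c)).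
  rewrite edge_sumE ler_wpM2l ?ge0_inv4d//.
  apply: ler_sum => i _; apply: ler_sum => j _; case: ifP => // _.
  by have := hPhi i j; lra.
have -> : \sum_(i <- Lam) \sum_(j <- neighbors i) c = (2 * d%:R) * (c * #|` Lam|%:R).
  rewrite (eq_bigr (fun=> (2 * d%:R) * c)); last first.
    move=> i _; rewrite big_const_seq count_predT size_neighbors iter_addr_0.
    by rewrite -[LHS]mulr_natl natrM.
  by rewrite big_const_seq count_predT iter_addr_0 -[LHS]mulr_natr mulrA.
have dd : (d%:R : R) != 0 by rewrite pnatr_eq0 -lt0n.
have -> : (4 * d%:R)^-1 * (2 * d%:R * (c * #|` Lam|%:R)) = 2^-1 * (c * #|` Lam|%:R).
  by field.
by rewrite ler_piMl ?mulr_ge0// invf_le1// ler1n.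
Qed.

Lemma edge_sum_norm_le Lam Phi Psi :
  `|edge_sum Lam Phi Psi| <= edge_sum Lam (fun i j => `|Phi i j|) (fun i => `|Psi i|).
Proof.
rewrite !edge_sumE normrM ger0_norm ?ge0_inv4d// ler_wpM2l ?ge0_inv4d//.
rewrite (le_trans (ler_norm_sum _ _ _))//; apply: ler_sum => i _.
rewrite (le_trans (ler_norm_sum _ _ _))//; apply: ler_sum => j _.
by case: ifP => // _; rewrite normrM ger0_norm.
Qed.

Lemma measurable_edge_sum disp (T : measurableType disp) Lam
    (Phi : T -> site d -> site d -> R) (Psi : T -> site d -> R) :
  (forall i j, measurable_fun setT (fun t => Phi t i j)) ->
  (forall i, measurable_fun setT (fun t => Psi t i)) ->
  measurable_fun setT (fun t => edge_sum Lam (Phi t) (Psi t)).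
Proof.
move=> mPhi mPsi; under eq_fun do rewrite edge_sumE.
apply: measurable_funM => //; apply: measurable_sum => i; apply: measurable_sum => j.
by case: (j \in Lam) => //; exact: measurable_funM.
Qed.

Lemma measurable_energy disp (T : measurableType disp) V Lam (f : T -> site d -> R) :
  measurable_fun [set: R] V ->
  (forall i, measurable_fun setT (fun t => f t i)) ->
  measurable_fun setT (fun t => energy V Lam (f t)).
Proof.
move=> mV mf; apply: measurable_edge_sum => [i j|i].
- by apply: measurableT_comp => //; exact: measurable_funB.
- exact: measurableT_comp.
Qed.

Lemma measurable_denergy disp (T : measurableType disp) W Lam (f : T -> site d -> R) u :
  measurable_fun [set: R] W ->
  (forall i, measurable_fun setT (fun t => f t i)) ->
  measurable_fun setT (fun t => denergy W Lam (f t) u).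
Proof.
move=> mV mf; apply: measurable_edge_sum => [i j|i].
- apply: measurable_funM => //.
  by apply: measurableT_comp => //; exact: measurable_funB.
- by apply: measurable_funM => //; exact: measurableT_comp.
Qed.

Lemma denergy_sumr W Lam f (I : Type) (s : seq I) (c : I -> R) (T : I -> site d -> R) :
  denergy W Lam f (fun i => \sum_(k <- s) c k * T k i) =
  \sum_(k <- s) c k * denergy W Lam f (T k).
Proof.
elim: s => [|k s IH].
  rewrite big_nil /denergy edge_sumE big1 ?mulr0// => i _; rewrite big1// => j _.
  by rewrite !big_nil subrr !mulr0 if_same.
rewrite big_cons -IH -[c k * _]edge_sumZ -edge_sumD; congr edge_sum.
- by apply/funext => i; apply/funext => j; rewrite !big_cons; ring.
- by apply/funext => i; rewrite !big_cons; ring.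
Qed.

Lemma denergy_idC Lam f u : denergy id Lam f u = denergy id Lam u f.
Proof.
by congr edge_sum; [apply/funext => i; apply/funext => j|apply/funext => i]; rewrite mulrC.
Qed.

Lemma denergy_id_sum Lam (I : Type) (s : seq I) (c : I -> R) (T : I -> site d -> R) :
  let u i := \sum_(k <- s) c k * T k i in
  denergy id Lam u u =
  \sum_(k <- s) \sum_(l <- s) c k * c l * denergy id Lam (T k) (T l).
Proof.
move=> u; rewrite {2}/u denergy_sumr; apply: eq_bigr => k _.
rewrite denergy_idC /u denergy_sumr mulr_sumr; apply: eq_bigr => l _.
by rewrite mulrA.
Qed.

Lemma denergy_id_diag Lam f : denergy id Lam f f = 2 * energy (fun t => t ^+ 2 / 2) Lam f.
Proof.
rewrite /energy -edge_sumZ; congr edge_sum.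
- by apply/funext => i; apply/funext => j; field.
- by apply/funext => i; field.
Qed.

Lemma energy_add_le V Lam f u :
  (forall x, derivable V x 1) -> (forall x, derivable (derive1 V) x 1) ->
  (forall x, derive1 (derive1 V) x <= 1) ->
  energy V Lam (fun i => f i + u i) <=
  energy V Lam f + denergy (derive1 V) Lam f u + 2^-1 * denergy id Lam u u.
Proof.
move=> dV dV' V''1; rewrite /energy /denergy -edge_sumZ -!edge_sumD.
apply: edge_sum_le => [i j|i].
- have := le_second_order (f i - f j) (u i - u j) dV dV' V''1.
  have -> : f i - f j + (u i - u j) = f i + u i - (f j + u j) by ring.
  by rewrite expr2; lra.
- by have := le_second_order (f i) (u i) dV dV' V''1; rewrite expr2; lra.
Qed.

Lemma energy_unit_le V Lam f (M : R) : (forall t, `|t| <= 1 -> `|V t| <= M) ->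
  (forall i, 0 <= f i <= 1) -> energy V Lam f <= M * #|` Lam|%:R.
Proof.
move=> VM f01.
have M0 : 0 <= M by rewrite (le_trans _ (VM 0 _)) ?normr0.
apply: edge_sum_cst_le => // [i j|i]; apply: le_trans (ler_norm _) _; apply: VM;
  rewrite ler_norml.
- by have := f01 i; have := f01 j; lra.
- by have := f01 i; lra.
Qed.

Lemma denergy_unit_bounded W Lam u (M : R) : (forall t, `|t| <= 1 -> `|W t| <= M) ->
  exists B, forall f, (forall i, 0 <= f i <= 1) -> `|denergy W Lam f u| <= B.
Proof.
move=> WM.
exists (edge_sum Lam (fun i j => M * `|u i - u j|) (fun i => M * `|u i|)) => f f01.
apply: le_trans (edge_sum_norm_le _ _ _) _; apply: edge_sum_le => [i j|i];
  rewrite normrM ler_wpM2r// WM// ler_norml.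
- by have := f01 i; have := f01 j; lra.
- by have := f01 i; lra.
Qed.

(* The energy controls the increments along the forest in which every site
   hangs from its neighbour in a fixed direction. *)
Lemma energy_ge_forest V Lam f (k : 'I_d) (H C : R) : 0 <= H -> 0 <= C ->
  (forall t, H * `|t| - C <= V t) -> (forall i, i \notin Lam -> f i = 0) ->
  \sum_(i <- Lam) (H / (8 * d%:R) * `|f i - f (i - delta_mx 0 k)| - C) <=
  energy V Lam f.
Proof.
move=> H0 C0 HV f0.
have dd : (d%:R : R) != 0 by rewrite pnatr_eq0 -lt0n.
rewrite -[leRHS]/(edge_sum _ _ _) edge_sumE mulr_sumr; apply: ler_sum => i _.
(* Interior pairs carry a factor 1/2 and boundary pairs do not; H / 2 times the increment, minus C,
   is below both contributions. *)
apply: (@le_trans _ _ ((4 * d%:R)^-1 *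
   \sum_(j <- neighbors i) (H / 2 * `|f i - f j| - C))); last first.
  rewrite ler_wpM2l ?ge0_inv4d//; apply: ler_sum => j _; case: ifPn => jL.
    by have := HV (f i - f j); lra.
  rewrite (f0 j)// subr0; apply: le_trans (HV _); have := normr_ge0 (f i); nra.
rewrite sumrB big_const_seq count_predT size_neighbors iter_addr_0 -[C *+ _]mulr_natl.
have pin : i - delta_mx 0 k \in neighbors i.
  by rewrite mem_cat; apply/orP; right; apply/mapP; exists k; rewrite ?mem_enum.
rewrite (big_rem _ pin)/=; set S := \sum_(j <- rem _ _) _.
have S0 : 0 <= S by apply: sumr_ge0 => j _; rewrite !mulr_ge0.
have -> : H / (8 * d%:R) * `|f i - f (i - delta_mx 0 k)| - C =
  (4 * d%:R)^-1 * (H / 2 * `|f i - f (i - delta_mx 0 k)| - 4 * d%:R * C) by field.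
rewrite ler_wpM2l ?ge0_inv4d// natrM.
have dC : 0 <= d%:R * C by rewrite mulr_ge0.
rewrite -!mulrA; move: (H * _) => X; move: (d%:R * C) dC => Y Y0; lra.
Qed.

End energy_theory.

(** * Partition functions and Gibbs means *)

Section spin_theory.
Context {R : realType} {d : nat}.
Notation RT := (measurableTypeR R).
Implicit Types (Lam : {fset site d}) (h : site d -> R).

Lemma spin_outside Lam (phi : #|` Lam|.-tuple RT) i : i \notin Lam -> spin phi i = 0.
Proof.
move=> iL; rewrite /spin nth_default// size_tuple.
by rewrite memNindex//.
Qed.

Lemma measurable_spin Lam i :
  measurable_fun setT (fun phi : #|` Lam|.-tuple RT => spin phi i).
Proof. exact: measurable_nth. Qed.

Lemma spin_shift_clip Lam (u : site d -> R) (psi : #|` Lam|.-tuple RT) i :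
  i \in Lam -> spin (shift_clip (fun k => u (nth 0 Lam k)) psi) i = clip (spin psi i) + u i.
Proof.
move=> iL; have ii : (index i Lam < #|` Lam|)%N by rewrite index_mem.
rewrite /spin -!(tnth_nth (0 : R) _ (Ordinal ii)) tnth_mktuple/=.
by rewrite nth_index.
Qed.

Definition cspin Lam (psi : #|` Lam|.-tuple RT) (i : site d) : R :=
  if i \in Lam then clip (spin psi i) else 0.

Lemma cspin_itv Lam (psi : #|` Lam|.-tuple RT) i : 0 <= cspin psi i <= 1.
Proof.
by rewrite /cspin; case: ifP => _; rewrite ?lexx ?ler01// clip_ge0 clip_le1.
Qed.

Lemma measurable_cspin Lam i :
  measurable_fun setT (fun psi : #|` Lam|.-tuple RT => cspin psi i).
Proof.
rewrite /cspin; case: (i \in Lam) => //.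
by apply: measurableT_comp; [exact: measurable_clip|exact: measurable_spin].
Qed.

Lemma spin_shift_clipE Lam (u : site d -> R) (psi : #|` Lam|.-tuple RT) :
  (forall i, i \notin Lam -> u i = 0) ->
  spin (shift_clip (fun k => u (nth 0 Lam k)) psi) = (fun i => cspin psi i + u i).
Proof.
move=> u0; apply/funext => i; rewrite /cspin; case: ifPn => iL.
  exact: spin_shift_clip.
by rewrite spin_outside// u0// addr0.
Qed.

End spin_theory.

Section gibbs_theory.
Context {R : realType} {d : nat}.
Notation RT := (measurableTypeR R).
Hypothesis d0 : (0 < d)%N.
Variable V : R -> R.
Hypothesis dV : forall t : R, derivable V t 1.
Hypothesis dV' : forall t : R, derivable (derive1 V) t 1.
Hypothesis V''1 : forall t : R, derive1 (derive1 V) t <= 1.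
Hypothesis V_growth : forall H : R, exists2 C, 0 <= C & forall t, H * `|t| - C <= V t.
Implicit Types (Lam : {fset site d}) (h : site d -> R) (eps : {nonneg R}).

Let cV : continuous V. Proof. exact: derivable_continuous. Qed.

Let mV : measurable_fun [set: R] V.
Proof. exact: continuous_measurable_fun. Qed.

Let mV' : measurable_fun [set: R] (derive1 V).
Proof. by apply: continuous_measurable_fun; exact: derivable_continuous. Qed.

Let k0 : 'I_d := Ordinal d0.
Let parent (i : site d) : site d := i - delta_mx 0 k0.
Let height (i : site d) : int := i 0 k0.

Let height_parent i : height (parent i) = height i - 1.
Proof. by rewrite /height /parent !mxE !eqxx. Qed.

Lemma measurable_boltzmann_weight Lam h :
  measurable_fun setT (fun phi : #|` Lam|.-tuple RT => boltzmann_weight V h phi).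
Proof.
rewrite /boltzmann_weight.
apply: (measurableT_comp (@measurable_expR R)); apply: measurable_funD.
  apply: measurableT_comp => //; apply: measurable_energy => // i.
  exact: measurable_spin.
by apply: measurable_sum => i; apply: measurable_funM => //; exact: measurable_spin.
Qed.

Lemma boltzmann_weight_gt0 Lam h (phi : #|` Lam|.-tuple RT) :
  0 < boltzmann_weight V h phi.
Proof. exact: expR_gt0. Qed.

(** Up to the factor exp(C), Lebesgue measure contributes at most 2 and the atom at most eps. This
    is the origin of the form B1 + B2 eps. *)
Lemma integral_pinned_kernel_le eps (C a : R) :
  (\int[pinned_lebesgue eps]_x (expR (C - `|x - a|))%:E <=
   (expR C * (2 + eps%:num))%:E)%E.
Proof.
have mK : measurable_fun [set: R] (fun x : R => (expR (C - `|x - a|))%:E).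
  apply/measurable_EFinP; apply: measurableT_comp => //.
  apply: measurable_funB => //; apply: measurableT_comp => //.
  exact: measurable_funB.
rewrite ge0_integral_measure_add//.
rewrite mulrDr EFinD; apply: leeD.
  under eq_integral do rewrite expRD EFinM.
  rewrite ge0_integralZl ?lee_fin ?expR_ge0//; last first.
    apply/measurable_EFinP; apply: measurableT_comp => //.
    by apply: measurableT_comp => //; apply: measurableT_comp => //; exact: measurable_funB.
  by rewrite EFinM lee_wpmul2l ?lee_fin ?expR_ge0// integral_expR_opp_norm.
rewrite ge0_integral_mscale//.
rewrite integral_dirac// diracT mul1e -EFinM lee_fin mulrC ler_wpM2r//.
by rewrite ler_expR gerBl.
Qed.

Lemma integral_forest_kernel_le eps Lam (C : R) :
  (\int[power_measure (pinned_lebesgue eps) #|` Lam|]_phi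
     (\prod_(i <- Lam) expR (C - `|spin phi i - spin phi (parent i)|))%:E <=
   ((expR C * (2 + eps%:num)) ^+ #|` Lam|)%:E)%E.
Proof.
apply: (@integral_prod_kernel_le R (site d) parent height (pinned_lebesgue eps)
  (fun t => expR (C - `|t|))) => //.
- by move=> i; rewrite height_parent gtrBl.
- by apply: measurableT_comp => //; apply: measurable_funB.
- by move=> a; exact: integral_pinned_kernel_le.
- exact: fset_uniq.
Qed.

(** The chain of parents of [i] leaves the box at the latest below its lowest site, and there the
    spin is 0; the increments along the chain telescope. *)
Lemma spin_le_increments Lam i : exists N : nat, forall phi : #|` Lam|.-tuple RT,
  `|spin phi i| <= N%:R * \sum_(j <- Lam) `|spin phi j - spin phi (parent j)|.
Proof.
have [N Nout] : exists N, iter N parent i \notin Lam.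
  have [->|] := eqVneq Lam fset0; first by exists 0%N; rewrite inE.
  move=> /fset0Pn[i0 i0L].
  have [|j _ jmin] := @seq_argmax _ (fun j => - height j) Lam.
    by rewrite -has_predT; apply/hasP; exists i0.
  have hN N : height (iter N parent i) = height i - N%:Z.
    elim: N => [|N IH]; first by rewrite subr0.
    by rewrite /= height_parent IH; lia.
  exists (absz (height i - height j)).+1; apply/negP => /jmin; rewrite hN; lia.
exists N => phi; set S := \sum_(j <- Lam) _.
have S0 : 0 <= S by apply: sumr_ge0.
elim: N i Nout => [|N IH] i Nout; first by rewrite spin_outside// normr0 mul0r.
have [iL|iL] := boolP (i \in Lam); last by rewrite spin_outside// normr0 mulr_ge0.
have := IH (parent i); rewrite -iterSr => /(_ Nout) IHp.
have : `|spin phi i - spin phi (parent i)| <= S.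
  by rewrite /S (big_rem _ iL)/= lerDl sumr_ge0.
have := ler_normD (spin phi i - spin phi (parent i)) (spin phi (parent i)).
rewrite subrK -natr1 mulrDl mul1r; lra.
Qed.

Lemma linear_le_increments Lam h : exists2 A : R, 0 <= A &
  forall phi : #|` Lam|.-tuple RT, \sum_(i <- Lam) h i * spin phi i <=
  A * \sum_(j <- Lam) `|spin phi j - spin phi (parent j)|.
Proof.
have [N NP] := choice (spin_le_increments Lam).
exists (\sum_(i <- Lam) `|h i| * (N i)%:R).
  by apply: sumr_ge0 => i _; rewrite mulr_ge0.
move=> phi; rewrite mulr_suml; apply: ler_sum => i _.
rewrite (le_trans (ler_norm _))// normrM -mulrA ler_wpM2l//.
Qed.

(** The slope is calibrated to [energy_ge_forest]: division by 8 d leaves A + 1, of which A absorbs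
    the field and 1 makes the kernel integrable. *)
Lemma boltzmann_weight_le_forest Lam h (A C : R) : 0 <= A -> 0 <= C ->
  (forall phi : #|` Lam|.-tuple RT, \sum_(i <- Lam) h i * spin phi i <=
     A * \sum_(j <- Lam) `|spin phi j - spin phi (parent j)|) ->
  (forall t, (A + 1) * (8 * d%:R) * `|t| - C <= V t) ->
  forall phi : #|` Lam|.-tuple RT, boltzmann_weight V h phi <=
    \prod_(i <- Lam) expR (C - `|spin phi i - spin phi (parent i)|).
Proof.
move=> A0 C0 hA VC phi; rewrite -expR_sum ler_expR.
have H0 : 0 <= (A + 1) * (8 * d%:R) by rewrite !mulr_ge0// addr_ge0.
have := energy_ge_forest d0 k0 H0 C0 VC (@spin_outside _ _ Lam phi).
have dd : (d%:R : R) != 0 by rewrite pnatr_eq0 -lt0n.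
have -> : (A + 1) * (8 * d%:R) / (8 * d%:R) = A + 1 by field.
rewrite !sumrB -mulr_sumr; have := hA phi; rewrite -/parent.
move: (\sum_(i <- Lam) `|_|) (\sum_(i <- Lam) C) (energy _ _ _) => x y z; lra.
Qed.

Lemma partition_function_lty eps Lam h : (partition_function V eps Lam h < +oo)%E.
Proof.
have [A A0 hA] := linear_le_increments Lam h.
have [C C0 VC] := V_growth ((A + 1) * (8 * d%:R)).
apply: (@le_lt_trans _ _ ((expR C * (2 + eps%:num)) ^+ #|` Lam|)%:E); last exact: ltry.
apply: le_trans (integral_forest_kernel_le eps Lam C).
apply: ge0_le_integral => //.
- by move=> phi _; rewrite lee_fin ltW// boltzmann_weight_gt0.
- by apply/measurable_EFinP; exact: measurable_boltzmann_weight.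
- apply/measurable_EFinP; apply: measurable_prod => i _; apply: measurableT_comp => //.
  apply: measurable_funB => //; apply: measurableT_comp => //.
  by apply: measurable_funB; exact: measurable_spin.
- move=> phi _; rewrite lee_fin; exact: boltzmann_weight_le_forest VC _.
Qed.

(** At zero field the slope, and hence [C], depends on V and d alone. This uniformity in the box and
    in eps is what makes B1 and B2 universal. *)
Lemma partition_function0_le : exists C : R, forall eps Lam,
  (partition_function V eps Lam (fun=> 0%R) <= ((expR C * (2 + eps%:num)) ^+ #|` Lam|)%:E)%E.
Proof.
have [C C0 VC] := V_growth ((0 + 1) * (8 * d%:R)).
exists C => eps Lam; apply: le_trans (integral_forest_kernel_le eps Lam C).
apply: ge0_le_integral => //.
- by move=> phi _; rewrite lee_fin ltW// boltzmann_weight_gt0.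
- by apply/measurable_EFinP; exact: measurable_boltzmann_weight.
- apply/measurable_EFinP; apply: measurable_prod => i _; apply: measurableT_comp => //.
  apply: measurable_funB => //; apply: measurableT_comp => //.
  by apply: measurable_funB; exact: measurable_spin.
- move=> phi _; rewrite lee_fin; apply: boltzmann_weight_le_forest VC _ => //.
  by move=> psi; rewrite mul0r big1// => i _; rewrite mul0r.
Qed.

Let refm eps Lam : {sigma_finite_measure set _ -> \bar R} :=
  power_measure (pinned_lebesgue eps) #|` Lam|.

Lemma integrable_boltzmann_weight eps Lam h :
  (refm eps Lam).-integrable setT (fun phi => (boltzmann_weight V h phi)%:E).
Proof.
apply/integrableP; split.
  by apply/measurable_EFinP; exact: measurable_boltzmann_weight.
under eq_integral do rewrite gee0_abs ?lee_fin ?ltW ?boltzmann_weight_gt0//.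
exact: partition_function_lty.
Qed.

Lemma boltzmann_weightD Lam h g (phi : #|` Lam|.-tuple RT) :
  boltzmann_weight V (fun i => h i + g i) phi =
  boltzmann_weight V h phi * expR (\sum_(i <- Lam) g i * spin phi i).
Proof.
rewrite /boltzmann_weight -expRD; congr expR; rewrite -addrA; congr (_ + _).
by rewrite -big_split/=; apply: eq_bigr => i _; rewrite mulrDl.
Qed.

(** |x| <= exp(x) + exp(-x), and the two exponentials amount to changing the field at [i] by 1 and
    by -1, for which the partition function is again finite. *)
Lemma integrable_spin_weight eps Lam h i :
  (refm eps Lam).-integrable setT (fun phi => (spin phi i * boltzmann_weight V h phi)%:E).
Proof.
have [iL|iL] := boolP (i \in Lam); last first.
  rewrite (_ : (fun _ => _) = cst 0%E); first exact: integrable0.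
  by apply/funext => phi; rewrite spin_outside// mul0r.
pose e (c : R) (j : site d) : R := c * (j == i)%:R.
have eE c (phi : #|` Lam|.-tuple RT) : \sum_(j <- Lam) e c j * spin phi j = c * spin phi i.
  rewrite (bigD1_seq i iL (fset_uniq _)) {1}/e eqxx mulr1 big1; first exact: addr0.
  move=> j ji; by rewrite /e (negbTE ji) mulr0 mul0r.
have i1 := integrable_boltzmann_weight eps Lam (fun j => h j + e 1 j).
have i2 := integrable_boltzmann_weight eps Lam (fun j => h j + e (-1) j).
apply: le_integrable (integrableD measurableT i1 i2) => //.
  apply/measurable_EFinP; apply: measurable_funM; first exact: measurable_spin.
  exact: measurable_boltzmann_weight.
move=> phi _; rewrite /= !boltzmann_weightD !eE mul1r mulN1r -?EFinD ?abse_EFin lee_fin.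
have w0 := boltzmann_weight_gt0 h phi; rewrite -mulrDr !normrM mulrC.
rewrite ler_wpM2l//; set x := spin phi i.
have h1 := expR_gt0 x; have h2 := expR_gt0 (- x).
rewrite [leRHS]ger0_norm; last by rewrite addr_ge0 ?ltW.
have h3 := expR_ge1Dx x; have h4 := expR_ge1Dx (- x).
by rewrite ler_norml; lra.
Qed.

Let linear_weightE Lam h g (phi : #|` Lam|.-tuple RT) :
  ((\sum_(i <- Lam) g i * spin phi i) * boltzmann_weight V h phi)%:E =
  (\sum_(i <- Lam) (g i)%:E * (spin phi i * boltzmann_weight V h phi)%:E)%E.
Proof.
rewrite mulr_suml -sumEFin; apply: eq_bigr => i _; rewrite -EFinM.
by rewrite mulrA.
Qed.

Lemma integrable_linear_weight eps Lam h g :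
  (refm eps Lam).-integrable setT
    (fun phi => ((\sum_(i <- Lam) g i * spin phi i) * boltzmann_weight V h phi)%:E).
Proof.
under eq_fun do rewrite linear_weightE.
apply: integrable_sum => // i _; apply: integrableZl => //.
exact: integrable_spin_weight.
Qed.

(* Jensen's inequality for the uniform law on the unit cube shifted by
   u = \sum_k h k * T k; since V'' <= 1, the cost of the shift is a Gaussian
   energy plus a term that is linear in h. *)
Lemma partition_function_ge : exists M : R, forall eps Lam (T : site d -> site d -> R),
  (forall k i, i \notin Lam -> T k i = 0) ->
  exists b : site d -> R, forall h,
  ((expR (\sum_(k <- Lam) \sum_(l <- Lam) h k * h l *
            (T l k - 2^-1 * denergy id Lam (T k) (T l)) +
         \sum_(k <- Lam) h k * b k - M * #|` Lam|%:R))%:E <=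
   partition_function V eps Lam h)%E.
Proof.
have [M VM] := continuous_bounded_itv 1 cV.
have cV' : continuous (derive1 V) by exact: derivable_continuous.
have [M' VM'] := continuous_bounded_itv 1 cV'.
exists M => eps Lam T T0; set n := #|` Lam|.
pose Q : {sigma_finite_measure set (n.-tuple RT) -> \bar R} := power_measure unit_uniform n.
have Q1 : Q setT = 1%E by apply: power_measure_setT; exact: probability_setT.
have qcst (c : R) : (\int[Q]_psi c%:E = c%:E)%E.
  by rewrite integral_cst// [X in (_ * X)%E]Q1 mule1.
have iqcst (c : R) : Q.-integrable setT (fun=> c%:E).
  apply/integrableP; split => //.
  by under eq_integral do rewrite abse_EFin; rewrite qcst ltry.
(* Coefficient of [h k] in the part of the exponent that is linear in [h]. Its mean [b k] is fixed
   before [h], so the linear term disappears under the expectation over centred fields. *)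
pose kap k (psi : n.-tuple RT) : R :=
  cspin psi k - denergy (derive1 V) Lam (cspin psi) (T k).
have mkap k : measurable_fun setT (kap k).
  apply: measurable_funB; first exact: measurable_cspin.
  by apply: measurable_denergy => // i; exact: measurable_cspin.
have ikap k : Q.-integrable setT (fun psi => (kap k psi)%:E).
  have [B BP] := denergy_unit_bounded Lam (T k) VM'.
  apply: (@le_integrable _ _ _ Q setT measurableT _ (cst (1 + B)%:E)) => //.
  - exact/measurable_EFinP.
  - move=> psi _; rewrite /= lee_fin /kap.
    have c01 := cspin_itv psi; have /andP[c0 c1] := c01 k.
    rewrite (le_trans (ler_normB _ _))// ger0_norm//.
    rewrite [leRHS]ger0_norm ?lerD ?BP//.
    by rewrite addr_ge0// (le_trans _ (BP _ c01)).
  - exact: iqcst.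
pose b k := fine (\int[Q]_psi (kap k psi)%:E)%E.
exists b => h; pose u i := \sum_(k <- Lam) h k * T k i.
have u0 i : i \notin Lam -> u i = 0.
  by move=> iL; rewrite /u big1// => k _; rewrite T0// mulr0.
pose A := \sum_(k <- Lam) \sum_(l <- Lam) h k * h l *
  (T l k - 2^-1 * denergy id Lam (T k) (T l)) - M * n%:R.
pose G psi := A + \sum_(k <- Lam) h k * kap k psi.
have mG : measurable_fun setT G.
  by apply: measurable_funD => //; apply: measurable_sum => k; exact: measurable_funM.
have iG : Q.-integrable setT (fun psi => (G psi)%:E).
  under eq_fun do rewrite /G EFinD -sumEFin.
  apply: integrableD => //.
  apply: integrable_sum => // k _.
  by under eq_fun do rewrite EFinM; exact: integrableZl.
have GE : (\int[Q]_psi (G psi)%:E = (A + \sum_(k <- Lam) h k * b k)%:E)%E.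
  under eq_integral do rewrite /G EFinD -sumEFin.
  rewrite integralD//; last first.
    apply: integrable_sum => // k _.
    by under eq_fun do rewrite EFinM; exact: integrableZl.
  have -> : (\int[Q]_x (\sum_(k <- Lam) (h k * kap k x)%:E) = (\sum_(k <- Lam) h k * b k)%:E)%E.
    rewrite integral_sum//; last first.
      by move=> k; under eq_fun do rewrite EFinM; exact: integrableZl.
    rewrite -sumEFin; apply: eq_bigr => k _.
    under eq_integral do rewrite EFinM.
    by rewrite integralZl// EFinM /b fineK// integrable_fin_num.
  by rewrite qcst -EFinD.
have J : ((expR (A + \sum_(k <- Lam) h k * b k))%:E <= \int[Q]_psi (expR (G psi))%:E)%E.
  (* Brings the bound into the form of [expR_integral_jensen] with f = 0 and z = 1, as [Q] has total
     mass 1. *)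
  rewrite -[X in X%:E]mul1r -[X in expR X]divr1.
  apply: (@expR_integral_jensen _ _ R Q (cst 0)) => //.
  - under eq_integral do rewrite /= expR0.
    exact: qcst.
  - by under eq_fun do rewrite /= expR0 subr0 mulr1.
  - by under eq_integral do rewrite /= expR0 subr0 mulr1.
rewrite addrAC -/A; apply: le_trans J _.
have mw := @measurable_boltzmann_weight Lam h.
apply: (@le_trans _ _ (\int[Q]_psi (boltzmann_weight V h
    (shift_clip (fun k => u (nth 0 Lam k)) psi : n.-tuple RT))%:E)%E); last first.
  apply: (@integral_shift_clip_le R (pinned_lebesgue eps) n _
    (fun phi : n.-tuple RT => (boltzmann_weight V h phi)%:E)).
  - move=> B mB.
    rewrite [leRHS](_ : _ = lebesgue_measure B + mscale eps (\d_((0%R : R) : RT)) B)%E.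
      by rewrite leeDl.
    exact: measure_addE.
  - exact/measurable_EFinP.
  - by move=> phi; rewrite lee_fin ltW// boltzmann_weight_gt0.
apply: ge0_le_integral => //.
- by apply/measurable_EFinP; exact: measurableT_comp.
- apply/measurable_EFinP; apply: (measurableT_comp mw).
  exact: measurable_shift_clip.
move=> psi _; rewrite lee_fin /boltzmann_weight ler_expR (spin_shift_clipE _ u0).
have := energy_add_le Lam (cspin psi) u dV dV' V''1.
have := energy_unit_le d0 Lam VM (@cspin_itv _ _ Lam psi).
rewrite /u denergy_sumr denergy_id_sum -/u /G /A /kap -/n.
have -> : \sum_(i <- Lam) h i * (cspin psi i + u i) =
   \sum_(i <- Lam) h i * cspin psi i + \sum_(k <- Lam) \sum_(l <- Lam) h k * h l * T l k.
  rewrite -big_split; apply: eq_bigr => k _; rewrite mulrDr; congr (_ + _).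
  by rewrite /u mulr_sumr; apply: eq_bigr => l _; rewrite mulrA.
have -> : \sum_(k <- Lam) \sum_(l <- Lam) h k * h l * (T l k - 2^-1 * denergy id Lam (T k) (T l)) =
   \sum_(k <- Lam) \sum_(l <- Lam) h k * h l * T l k -
   2^-1 * \sum_(k <- Lam) \sum_(l <- Lam) h k * h l * denergy id Lam (T k) (T l).
  rewrite mulr_sumr -sumrB; apply: eq_bigr => k _; rewrite mulr_sumr -sumrB.
  by apply: eq_bigr => l _; ring.
have -> : \sum_(k <- Lam) h k * (cspin psi k - denergy (derive1 V) Lam (cspin psi) (T k)) =
   \sum_(k <- Lam) h k * cspin psi k -
   \sum_(k <- Lam) h k * denergy (derive1 V) Lam (cspin psi) (T k).
  by rewrite -sumrB; apply: eq_bigr => k _; rewrite mulrBr.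
lra.
Qed.

Lemma measurable_integral_param disp (T : measurableType disp) n
    (m : {sigma_finite_measure set (n.-tuple RT) -> \bar R}) (F : T * n.-tuple RT -> R) :
  measurable_fun setT F ->
  measurable_fun setT (fun w => \int[m]_phi (F (w, phi))%:E)%E.
Proof.
move=> mF; have mFE : measurable_fun setT (EFin \o F) by exact/measurable_EFinP.
have -> : (fun w => \int[m]_phi (F (w, phi))%:E)%E =
    ((fun w => \int[m]_phi (EFin \o F)^\+ (w, phi)) \-
     (fun w => \int[m]_phi (EFin \o F)^\- (w, phi)))%E.
  apply/funext => w /=; rewrite integralE; congr (_ - _)%E; apply: eq_integral => phi _.
  - by rewrite !funeposE.
  - by rewrite !funenegE.
apply: emeasurable_funB.
- apply: (measurable_fun_fubini_tonelli_F (m2 := m)) => //; exact: measurable_funepos.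
- apply: (measurable_fun_fubini_tonelli_F (m2 := m)) => //; exact: measurable_funeneg.
Qed.

Let Z eps Lam h : R := fine (partition_function V eps Lam h).

Lemma partition_function_fineK eps Lam h :
  partition_function V eps Lam h = (fine (partition_function V eps Lam h))%:E.
Proof.
rewrite fineK// ge0_fin_numE ?partition_function_lty//.
by apply: integral_ge0 => phi _; rewrite lee_fin ltW// boltzmann_weight_gt0.
Qed.

(** With all test functions equal to 0, the lower bound of [partition_function_ge] is already an
    exponential. *)
Lemma fine_partition_function_gt0 eps Lam h : 0 < fine (partition_function V eps Lam h).
Proof.
have [M MP] := partition_function_ge.
have [//|b /(_ h)] := MP eps Lam (fun _ _ => 0).
by rewrite partition_function_fineK lee_fin; apply: lt_le_trans; exact: expR_gt0.
Qed.

Lemma gibbs_mean_spinE eps Lam h i :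
  (gibbs_mean V eps Lam h (fun phi => spin phi i))%:E =
  ((Z eps Lam h)^-1%:E * \int[refm eps Lam]_phi (spin phi i * boltzmann_weight V h phi)%:E)%E.
Proof.
have Z0 : 0 <= (Z eps Lam h)^-1 by rewrite invr_ge0 ltW// fine_partition_function_gt0.
have := @integral_scaled_density _ _ R (refm eps Lam) (boltzmann_weight V h)
  (@measurable_boltzmann_weight Lam h) (fun phi => ltW (boltzmann_weight_gt0 h phi))
  _ (fun phi => spin phi i) Z0 (@measurable_spin _ _ Lam i) (integrable_spin_weight eps Lam h i).
rewrite /gibbs_mean => E.
have -> : (\int[gibbs V eps Lam h]_phi (spin phi i)%:E)%E =
  ((Z eps Lam h)^-1%:E * \int[refm eps Lam]_phi (spin phi i * boltzmann_weight V h phi)%:E)%E.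
  exact: E.
rewrite fineK// fin_numM// integrable_fin_num//; exact: integrable_spin_weight.
Qed.

Lemma measurable_gibbs_mean_spin disp (T : measurableType disp) (eta : T -> site d -> R)
    eps Lam i : (forall j, measurable_fun setT (fun w => eta w j)) ->
  measurable_fun setT (fun w => gibbs_mean V eps Lam (eta w) (fun phi => spin phi i)).
Proof.
move=> meta.
have mspin j : measurable_fun setT
    (fun q : T * #|` Lam|.-tuple RT => spin q.2 j).
  exact: (measurableT_comp (@measurable_spin _ _ Lam j) measurable_snd).
have mw : measurable_fun setT
    (fun q : T * #|` Lam|.-tuple RT => boltzmann_weight V (eta q.1) q.2).
  rewrite /boltzmann_weight.
  apply: (measurableT_comp (@measurable_expR R)); apply: measurable_funD.
    apply: measurableT_comp => //; exact: measurable_energy.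
  apply: measurable_sum => j; apply: measurable_funM => //.
  exact: (measurableT_comp (meta j) measurable_fst).
(* As Z > 0, its inverse is [expR (- ln Z)], a composition of measurable functions. *)
rewrite (_ : (fun _ => _) = (fun w => expR (- ln (Z eps Lam (eta w))) *
  fine (\int[refm eps Lam]_phi (spin phi i * boltzmann_weight V (eta w) phi)%:E)%E)); last first.
  apply/funext => w; apply: EFin_inj; rewrite gibbs_mean_spinE EFinM fineK; last first.
    by rewrite integrable_fin_num//; exact: integrable_spin_weight.
  by rewrite expRN lnK// posrE fine_partition_function_gt0.
apply: measurable_funM.
  apply: measurableT_comp => //; apply: measurableT_comp => //.
  apply: (measurableT_comp (@measurable_ln R)); apply: (measurableT_comp (fine_measurable measurableT)).
  exact: (measurable_integral_param (refm eps Lam) mw).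
apply: (measurableT_comp (fine_measurable measurableT)).
apply: (measurable_integral_param (refm eps Lam)
  (F := fun q => spin q.2 i * boltzmann_weight V (eta q.1) q.2)).
exact: measurable_funM.
Qed.

Lemma linear_gibbs_meanE eps Lam h g :
  (Z eps Lam h * \sum_(i <- Lam) g i * gibbs_mean V eps Lam h (fun phi => spin phi i))%:E =
  (\int[refm eps Lam]_phi
     ((\sum_(i <- Lam) g i * spin phi i) * boltzmann_weight V h phi)%:E)%E.
Proof.
under eq_integral do rewrite linear_weightE.
rewrite integral_sum//; last by move=> i; apply: integrableZl => //; exact: integrable_spin_weight.
rewrite mulr_sumr -sumEFin; apply: eq_bigr => i _.
rewrite integralZl//; last exact: integrable_spin_weight.
rewrite mulrCA EFinM; congr (_ * _)%E; rewrite EFinM gibbs_mean_spinE muleA -EFinM divff ?mul1e//.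
by rewrite gt_eqF// fine_partition_function_gt0.
Qed.

(** The tangent inequality for the convex function h |-> ln Z[h], whose gradient is the vector of
    Gibbs means. *)
Lemma gibbs_jensen eps Lam h g (mu : site d -> R) :
  (forall i, mu i = gibbs_mean V eps Lam h (fun phi => spin phi i)) ->
  Z eps Lam h * expR (\sum_(i <- Lam) (g i - h i) * mu i) <= Z eps Lam g.
Proof.
move=> muE; under eq_bigr do rewrite muE.
set S := \sum_(i <- Lam) _.
have Z0 : 0 < Z eps Lam h by exact: fine_partition_function_gt0.
rewrite -lee_fin -[leRHS]partition_function_fineK.
have -> : S = Z eps Lam h * S / Z eps Lam h by rewrite mulrC mulKf// gt_eqF.
pose f h' (phi : #|` Lam|.-tuple RT) : R :=
  - energy V Lam (spin phi) + \sum_(i <- Lam) h' i * spin phi i.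
have mf h' : measurable_fun setT (f h').
  apply: measurable_funD.
    apply: measurableT_comp => //; apply: measurable_energy => // i.
    exact: measurable_spin.
  by apply: measurable_sum => i; apply: measurable_funM => //; exact: measurable_spin.
have dE (phi : #|` Lam|.-tuple RT) :
    f g phi - f h phi = \sum_(i <- Lam) (g i - h i) * spin phi i.
  under eq_bigr do rewrite mulrBl.
  by rewrite sumrB /f; ring.
apply: (@expR_integral_jensen _ _ R (refm eps Lam) (f h) (f g)) => //.
- by rewrite -partition_function_fineK.
- by under eq_fun do rewrite dE; exact: integrable_linear_weight.
- by under eq_integral do rewrite dE; rewrite linear_gibbs_meanE.
Qed.

(** The gradient of a convex function is monotone: combine the tangent inequalities at 0 and at
    [h]. *)
Lemma gibbs_mean_monotone eps Lam h (mu0 mu : site d -> R) :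
  (forall i, mu0 i = gibbs_mean V eps Lam (fun=> 0) (fun phi => spin phi i)) ->
  (forall i, mu i = gibbs_mean V eps Lam h (fun phi => spin phi i)) ->
  \sum_(i <- Lam) h i * mu0 i <= \sum_(i <- Lam) h i * mu i.
Proof.
move=> mu0E muE.
have := gibbs_jensen (fun=> 0) muE; have := gibbs_jensen h mu0E.
have Zh : 0 < Z eps Lam h by exact: fine_partition_function_gt0.
have : 0 < Z eps Lam (fun=> 0) by exact: fine_partition_function_gt0.
move: Zh (Z eps Lam (fun=> 0)); move: (Z eps Lam h) => zh zh0 z0 z00.
have -> : \sum_(i <- Lam) (h i - 0) * mu0 i = \sum_(i <- Lam) h i * mu0 i.
  by apply: eq_bigr => i _; rewrite subr0.
have -> : \sum_(i <- Lam) (0 - h i) * mu i = - \sum_(i <- Lam) h i * mu i.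
  by rewrite -sumrN; apply: eq_bigr => i _; rewrite sub0r mulNr.
move: (\sum_(i <- Lam) h i * mu0 i) (\sum_(i <- Lam) h i * mu i) => s0 s h1 h2.
rewrite -subr_le0 -ler_expR expR0 expRD -(ler_pM2l zh0) mulr1; apply: le_trans h1.
by rewrite [expR s0 * _]mulrC mulrA ler_wpM2r ?expR_ge0.
Qed.

Lemma gibbs_mean_ge : exists B1 B2 : R, 0 < B1 /\ 0 < B2 /\
  forall eps Lam (T : site d -> site d -> R),
  (forall k i, i \notin Lam -> T k i = 0) ->
  exists b : site d -> R, forall h (mu : site d -> R),
  (forall i, mu i = gibbs_mean V eps Lam h (fun phi => spin phi i)) ->
  \sum_(k <- Lam) \sum_(l <- Lam) h k * h l *
      (T l k - 2^-1 * denergy id Lam (T k) (T l)) +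
  \sum_(k <- Lam) h k * b k - #|` Lam|%:R * ln (B1 + B2 * eps%:num) <= \sum_(i <- Lam) h i * mu i.
Proof.
have [C CP] := partition_function0_le.
have [M MP] := partition_function_ge.
(* [M] bounds the energy per site of heights in the unit cube, and [C] is the forest constant at
   zero field. Together they give B1 + B2 eps = exp(M + C) (2 + eps). *)
exists (expR (M + C) * 2), (expR (M + C)); split; first by rewrite mulr_gt0 ?expR_gt0.
split; first exact: expR_gt0.
move=> eps Lam T T0; have [b bP] := MP eps Lam T T0; exists b => h mu muE.
have e2 : 0 < 2 + eps%:num :> R by rewrite ltr_wpDr.
have -> : ln (expR (M + C) * 2 + expR (M + C) * eps%:num) = M + (C + ln (2 + eps%:num)).
  by rewrite -mulrDr lnM ?posrE ?expR_gt0// expRK addrA.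
set S := \sum_(i <- Lam) h i * mu i.
have := bP h; rewrite partition_function_fineK lee_fin.
set X := \sum_(k <- Lam) \sum_(l <- Lam) _; set Y := \sum_(k <- Lam) h k * b k.
move=> lo; have := CP eps Lam; rewrite partition_function_fineK lee_fin => up.
have := gibbs_jensen (fun=> 0) muE.
have -> : \sum_(i <- Lam) (0 - h i) * mu i = - S.
  by rewrite /S -sumrN; apply: eq_bigr => i _; rewrite sub0r mulNr.
move=> jen.
have h1 : expR (X + Y - M * #|` Lam|%:R - S) <= (expR C * (2 + eps%:num)) ^+ #|` Lam|.
  apply: le_trans up; apply: le_trans jen.
  by rewrite expRD ler_wpM2r ?expR_ge0.
have h2 : (expR C * (2 + eps%:num)) ^+ #|` Lam| = expR ((C + ln (2 + eps%:num)) * #|` Lam|%:R).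
  by rewrite expRM_natr expRD lnK.
move: h1; rewrite h2 ler_expR; lra.
Qed.

End gibbs_theory.

(** * Independent symmetric fields *)

Section extended_integrals.
Local Open Scope ereal_scope.
Context d (T : measurableType d) (R : realType).
Variable mu : {measure set T -> \bar R}.

Lemma integrable_funeposneg (f : T -> \bar R) : measurable_fun setT f ->
  \int[mu]_x f^\+ x < +oo -> \int[mu]_x f^\- x < +oo -> mu.-integrable setT f.
Proof.
move=> mf fpos fneg; apply/integrableP; split => //.
rewrite (eq_integral (fun x => f^\+ x + f^\- x)); last first.
  by move=> x _; rewrite -/((abse \o f) x) fune_abse.
rewrite ge0_integralD//; last 2 first.
- exact: measurable_funepos.
- exact: measurable_funeneg.
exact: lte_add_pinfty.
Qed.

(** The integrable minorant keeps the negative part of [g] finite, so the integral of [g] is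
    meaningful even when it is +oo. *)
Lemma le_integral_integrablel (f g : T -> R) :
  mu.-integrable setT (EFin \o f) -> measurable_fun setT g ->
  (forall x, (f x <= g x)%R) -> \int[mu]_x (f x)%:E <= \int[mu]_x (g x)%:E.
Proof.
move=> fi mg fg; have mgE : measurable_fun setT (EFin \o g) by exact/measurable_EFinP.
have mf := measurable_int mu fi.
have gneg : \int[mu]_x (EFin \o g)^\- x < +oo.
  apply: le_lt_trans (integral_funeneg_lt_pinfty measurableT fi).
  apply: ge0_le_integral => //; [exact: measurable_funeneg|exact: measurable_funeneg|].
  move=> x _; rewrite !funenegE /= -!EFin_max lee_fin ge_max !le_max lerN2 fg/=.
  by rewrite lexx orbT.
have [gpos|] := boolP (\int[mu]_x (EFin \o g)^\+ x < +oo).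
  apply: le_integral => //; last by move=> x _; rewrite lee_fin.
  exact: integrable_funeposneg.
rewrite -leNgt leye_eq => /eqP gpos.
rewrite [leRHS](_ : _ = +oo) ?leey// -[LHS]/(\int[mu]_x (EFin \o g) x) integralE gpos.
rewrite addye// eqe_oppLR /=; apply/eqP => E; by move: gneg; rewrite E.
Qed.

(** If some positive part has infinite integral, the right-hand side is +oo, because no summand is
    -oo. Otherwise every summand is integrable and equality holds. *)
Lemma integral_sum_le (I : eqType) (s : seq I) (f : I -> T -> R) :
  (forall i, i \in s -> measurable_fun setT (f i)) ->
  (forall i, i \in s -> \int[mu]_x (EFin \o f i)^\- x < +oo) ->
  \int[mu]_x (\sum_(i <- s) f i x)%:E <= \sum_(i <- s) \int[mu]_x (f i x)%:E.
Proof.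
move=> mf fneg.
have [fpos|] := pselect (forall i, i \in s -> \int[mu]_x (EFin \o f i)^\+ x < +oo).
  have fi i : i \in s -> mu.-integrable setT (EFin \o f i).
    move=> si; apply: integrable_funeposneg; [|exact: fpos|exact: fneg].
    by apply/measurable_EFinP; exact: mf.
  under eq_integral do rewrite -sumEFin big_seq.
  pose g i x := if i \in s then (f i x)%:E else 0.
  have gi i : mu.-integrable setT (g i).
    by rewrite /g; have [si|_] := boolP (i \in s); [exact: fi|exact: integrable0].
  rewrite (eq_integral (fun x => \sum_(i <- s) g i x)); last first.
    by move=> x _; rewrite [RHS]big_seq; apply: eq_bigr => i si; rewrite /g si.
  rewrite integral_sum// big_seq [leRHS]big_seq le_eqVlt; apply/orP; left; apply/eqP.
  by apply: eq_bigr => i si; rewrite /g si.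
move=> /existsNP[i /not_implyP[si /negP]]; rewrite -leNgt leye_eq => /eqP ipos.
have fE j : \int[mu]_x (f j x)%:E = \int[mu]_x (EFin \o f j)^\+ x - \int[mu]_x (EFin \o f j)^\- x.
  by rewrite -[LHS]/(\int[mu]_x (EFin \o f j) x) integralE.
have nNy j : j \in s -> \int[mu]_x (f j x)%:E != -oo.
  move=> js; rewrite fE; have n := fneg _ js.
  have p : 0 <= \int[mu]_x (EFin \o f j)^\+ x by exact: integral_ge0.
  by move: p n; case: (\int[mu]_x (EFin \o f j)^\+ x) => [a| |];
    case: (\int[mu]_x (EFin \o f j)^\- x).
rewrite [leRHS](_ : _ = +oo) ?leey// big_seq; apply/esum_eqyP; first exact: nNy.
exists i; split => //; rewrite fE ipos addye//.
by move: (fneg _ si); case: (\int[mu]_x (EFin \o f i)^\- x).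
Qed.

End extended_integrals.

Lemma limn_einf_ge (R : realType) (u : (\bar R)^nat) (c : \bar R) :
  (\forall n \near \oo, c <= u n)%E -> (c <= limn_einf u)%E.
Proof.
move=> [N _ Nc]; rewrite /limn_einf leeNr; apply: ge_ereal_inf.
exists (ereal_sup [set (\- u)%E n | n in [set n | (N <= n)%N]]).
  by exists [set n | (N <= n)%N] => //; exists N.
apply: ge_ereal_sup => _ [n /= Nn <-]; rewrite leeN2; exact: Nc.
Qed.

(** * Moments of the random fields *)

Section random_fields.
Local Open Scope ereal_scope.
Context (R : realType) (disp : measure_display) (Omega : measurableType disp)
  (P : probability Omega R) (I : choiceType) (eta : I -> {RV P >-> R}) (i0 : I).
Hypothesis indep : mutually_independent eta.
Hypothesis ident : identically_distributed eta.
Hypothesis symm : symmetrically_distributed eta.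
Hypothesis eta2 : 'E_P[fun w => (eta i0 w ^+ 2)%R] < +oo.

Let msq : measurable_fun [set: R] (fun x : R => (x ^+ 2)%:E).
Proof. by apply/measurable_EFinP; exact: measurable_funX. Qed.

Lemma field_second_momentE i :
  \int[P]_w (eta i w ^+ 2)%:E = 'E_P[fun w => (eta i0 w ^+ 2)%R].
Proof.
have sq0 (x : R) : 0 <= (x ^+ 2)%:E by rewrite lee_fin sqr_ge0.
rewrite unlock.
rewrite -(ge0_integral_distribution (eta i) msq sq0).
rewrite -(ge0_integral_distribution (eta i0) msq sq0).
by apply: eq_measure_integral => A mA _; exact: ident.
Qed.

Definition field_variance : R := fine 'E_P[fun w => (eta i0 w ^+ 2)%R].

Lemma field_varianceE : 'E_P[fun w => (eta i0 w ^+ 2)%R] = field_variance%:E.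
Proof.
rewrite fineK// ge0_fin_numE// unlock; apply: integral_ge0 => w _.
by rewrite lee_fin sqr_ge0.
Qed.

Lemma field_variance_ge0 : (0 <= field_variance)%R.
Proof.
rewrite -lee_fin -field_varianceE unlock; apply: integral_ge0 => w _.
by rewrite lee_fin sqr_ge0.
Qed.

Let ieta2 i : P.-integrable setT (fun w => (eta i w ^+ 2)%:E).
Proof.
apply/integrableP; split.
  by apply/measurable_EFinP; exact: measurable_funX.
under eq_integral do rewrite gee0_abs ?lee_fin ?sqr_ge0//.
by rewrite field_second_momentE.
Qed.

Lemma integrable_field_mul i j : P.-integrable setT (fun w => (eta i w * eta j w)%:E).
Proof.
apply: le_integrable (integrableD measurableT (ieta2 i) (ieta2 j)) => //.
  by apply/measurable_EFinP; exact: measurable_funM.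
move=> w _; rewrite -EFinD !abse_EFin lee_fin.
rewrite [leRHS]ger0_norm ?addr_ge0 ?sqr_ge0//.
move: (eta i w) (eta j w) => x y; rewrite ler_norml.
have := sqr_ge0 (x - y); have := sqr_ge0 (x + y); rewrite sqrrB sqrrD.
have := sqr_ge0 x; have := sqr_ge0 y; move: (x ^+ 2)%R (y ^+ 2)%R (x * y)%R.
by move=> a b c a0 b0 p0 n0; apply/andP; split; lra.
Qed.

Lemma integrable_field i : P.-integrable setT (fun w => (eta i w)%:E).
Proof.
have i1 : P.-integrable setT (fun=> 1%:E : \bar R).
  by apply: finite_measure_integrable_cst.
apply: le_integrable (integrableD measurableT i1 (ieta2 i)) => //.
  exact/measurable_EFinP.
move=> w _; rewrite -EFinD !abse_EFin lee_fin.
rewrite [leRHS]ger0_norm ?addr_ge0 ?sqr_ge0//.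
move: (eta i w) => x; rewrite ler_norml.
have := sqr_ge0 (x - 1); have := sqr_ge0 (x + 1); rewrite sqrrB sqrrD expr1n mulr1.
by have := sqr_ge0 x; move: (x ^+ 2)%R => a a0 p0 n0; apply/andP; split; lra.
Qed.

Lemma integral_field_eq0 i : \int[P]_w (eta i w)%:E = 0.
Proof.
have D : \int[distribution P (eta i)]_x x%:E = \int[P]_w (eta i w)%:E.
  by rewrite integral_distribution//; exact: integrable_field.
have iD : (distribution P (eta i)).-integrable setT EFin.
  by apply: integrable_pushforward => //; exact: integrable_field.
have E : \int[distribution P (eta i)]_x x%:E = - \int[distribution P (eta i)]_x x%:E.
  rewrite -integralN/=; last by apply: integrable_add_def.
  transitivity (\int[pushforward (distribution P (eta i)) (-%R : R -> R)]_x x%:E).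
    by apply: eq_measure_integral => A mA _; exact: symm.
  rewrite integral_pushforward//= preimage_setT.
  exact: (integrableN iD).
move: E; rewrite D.
have : \int[P]_w (eta i w)%:E \is a fin_num by apply: integrable_fin_num; [|exact: integrable_field].
case: (\int[P]_w (eta i w)%:E) => // r _ E.
have {E} rr : r = (- r)%R by exact: EFin_inj E.
by congr EFin; lra.
Qed.

(** Independence on rectangles identifies the joint law with the product law, by uniqueness of the
    product measure; Fubini then leaves a centred inner integral. *)
Lemma integral_field_mul_eq0 i j : i != j -> \int[P]_w (eta i w * eta j w)%:E = 0.
Proof.
move=> ij.
pose X w : R * R := (eta i w, eta j w).
have mX : measurable_fun setT X by exact: measurable_fun_pair.
pose Xm : {mfun Omega >-> (R * R)%type} := HB.pack X (isMeasurableFun.Build _ _ _ _ X mX).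
pose f (p : R * R) := (p.1 * p.2)%:E.
have mf : measurable_fun setT f by apply/measurable_EFinP; exact: measurable_funM.
have E A : measurable A ->
    (distribution P (eta i) \x distribution P (eta j)) A = distribution P Xm A.
  apply: product_measure_unique => {}A B mA mB.
  pose C k := if k == i then A else B.
  have := @indep [:: i; j] C; rewrite /= inE ij => /(_ isT).
  have mC k : k \in [:: i; j] -> measurable (C k) by rewrite /C; case: ifP.
  move=> /(_ mC); rewrite !big_cons big_nil mule1 /C eqxx eq_sym (negbTE ij) => <-.
  rewrite /distribution /pushforward; congr (P _); apply/seteqP; split=> w /=.
    move=> [Aw Bw] k; rewrite /= !inE => /orP[]/eqP ->; first by rewrite eqxx.
    by rewrite eq_sym (negbTE ij).
  move=> H; split; first by have := H i; rewrite /= eqxx; apply; rewrite mem_head.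
  by have := H j; rewrite /= eq_sym (negbTE ij); apply; rewrite !inE eqxx orbT.
have if' : (distribution P Xm).-integrable setT f.
  by apply: integrable_pushforward => //; exact: integrable_field_mul.
have ifp : (distribution P (eta i) \x distribution P (eta j)).-integrable setT f.
  apply/integrableP; split => //.
  have /integrableP[_] := if'; congr (_ < _).
  by apply: eq_measure_integral => A mA _; apply/esym; exact: E.
transitivity (\int[distribution P Xm]_p f p).
  by rewrite integral_distribution//; exact: integrable_field_mul.
transitivity (\int[distribution P (eta i) \x distribution P (eta j)]_p f p).
  by apply: eq_measure_integral => A mA _; apply/esym; exact: E.
rewrite -(integral12_prod_meas1 ifp) /fubini_F /f/=.
have iD k : (distribution P (eta k)).-integrable setT EFin.
  by apply: integrable_pushforward => //; exact: integrable_field.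
have D k : \int[distribution P (eta k)]_x x%:E = 0.
  by rewrite integral_distribution ?integral_field_eq0//; exact: integrable_field.
apply: integral0_eq => x _.
under eq_integral do rewrite EFinM.
rewrite integralZl//; last exact: iD.
by rewrite [X in _ * X]D mule0.
Qed.

Lemma integral_field_quadratic (s : seq I) (a : I -> I -> R) (b : I -> R) (c : R) :
  uniq s ->
  let Y w := (\sum_(k <- s) \sum_(l <- s) eta k w * eta l w * a k l +
              \sum_(k <- s) eta k w * b k - c)%R in
  P.-integrable setT (EFin \o Y) /\
  \int[P]_w (Y w)%:E = (field_variance * (\sum_(k <- s) a k k) - c)%:E.
Proof.
move=> us Y.
pose F w := \sum_(k <- s) (\sum_(l <- s) (a k l)%:E * (eta k w * eta l w)%:E) +
    \sum_(k <- s) (b k)%:E * (eta k w)%:E + (- c)%:E.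
have YE w : (Y w)%:E = F w.
  rewrite /Y !EFinD -!sumEFin; congr (_ + _ + _); apply: eq_bigr => k _.
    by rewrite -sumEFin; apply: eq_bigr => l _; rewrite -EFinM mulrC.
  by rewrite -EFinM mulrC.
have i2 k l : P.-integrable setT (fun w => (a k l)%:E * (eta k w * eta l w)%:E).
  by apply: integrableZl => //; exact: integrable_field_mul.
have i2s k : P.-integrable setT (fun w => \sum_(l <- s) (a k l)%:E * (eta k w * eta l w)%:E).
  by apply: integrable_sum.
have i2ss : P.-integrable setT
    (fun w => \sum_(k <- s) (\sum_(l <- s) (a k l)%:E * (eta k w * eta l w)%:E)).
  by apply: integrable_sum.
have i1 k : P.-integrable setT (fun w => (b k)%:E * (eta k w)%:E).
  by apply: integrableZl => //; exact: integrable_field.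
have i1s : P.-integrable setT (fun w => \sum_(k <- s) (b k)%:E * (eta k w)%:E).
  by apply: integrable_sum.
have i0c : P.-integrable setT (fun=> (- c)%:E) by exact: finite_measure_integrable_cst.
split.
  rewrite (_ : EFin \o Y = F); last by apply/funext => w; exact: YE.
  by apply: integrableD => //; exact: integrableD.
under eq_integral do rewrite YE /F.
rewrite integralD//; last exact: integrableD.
rewrite integralD// integral_cst// [X in _ * X]probability_setT mule1 EFinD.
congr (_ + _); rewrite !integral_sum//.
rewrite [X in _ + X]big1 ?adde0; last first.
  by move=> k _; rewrite integralZl ?integral_field_eq0 ?mule0//; exact: integrable_field.
rewrite mulr_sumr -sumEFin big_seq [RHS]big_seq; apply: eq_bigr => k ks.
rewrite integral_sum// (bigD1_seq k ks us) /= big1 ?adde0.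
  rewrite integralZl//; last exact: integrable_field_mul.
  rewrite mulrC EFinM -field_varianceE -(field_second_momentE k).
  by under eq_integral do rewrite -expr2.
move=> l lk; rewrite integralZl//; last exact: integrable_field_mul.
by rewrite integral_field_mul_eq0 ?mule0// eq_sym.
Qed.

End random_fields.

(** * Boxes and truncated Green functions *)

Section boxes.
Context {R : realType} {d : nat}.

Lemma card_box L : #|` box d L| = ((2 * L).+1 ^ d)%N.
Proof.
rewrite card_fseq undup_id; last first.
  rewrite map_inj_uniq ?enum_uniq// => x y /rowP xy; apply/rowP => k.
  by apply: val_inj; move: (xy k); rewrite !mxE => /addIr [].
by rewrite size_map -cardE card_mx card_ord mul1n mul2n.
Qed.

Lemma finite_set_in_box (A : set (site d)) : finite_set A ->
  exists r, forall i, A i -> i \in box d r.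
Proof.
move=> fA; exists (\sum_(i <- fset_set A) \sum_(k < d) absz (i 0%R k))%N => i Ai.
have iA : i \in fset_set A by rewrite in_fset_set// inE.
rewrite in_box; apply/forallP => k.
have : (absz (i 0%R k) <= \sum_(i <- fset_set A) \sum_(k < d) absz (i 0%R k))%N.
  by rewrite (big_rem _ iA)/= (bigD1 k)//= -addnA leq_addr.
lia.
Qed.

Lemma bernoulli_le (t : R) n : 0 <= t <= 1 -> 1 - n%:R * t <= (1 - t) ^+ n.
Proof.
move=> /andP[t0 t1]; elim: n => [|n IH]; first by rewrite mul0r subr0 expr0.
have t1' : 0 <= 1 - t by lra.
apply: le_trans (_ : (1 - t) * (1 - n%:R * t) <= _); last first.
  by rewrite exprS ler_wpM2l.
have : 0 <= n%:R * t * t by rewrite !mulr_ge0.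
rewrite -natr1; move: (n%:R : R) => x; nra.
Qed.

(** The side shrinks by the factor 1 - t with t = 2 r / (2 L + 1), and Bernoulli's inequality bounds
    the d-th power. *)
Lemma card_box_sub_ge r L : (r <= L)%N ->
  #|` box d L|%:R * (1 - d%:R * (2 * r%:R / (2 * L)%N.+1%:R)) <= #|` box d (L - r)|%:R :> R.
Proof.
move=> rL; rewrite !card_box !natrX.
have N0 : 0 < (2 * L).+1%:R :> R by rewrite ltr0n.
have rle : 2 * r%:R <= (2 * L).+1%:R :> R by rewrite -natrM ler_nat; lia.
apply: (@le_trans _ _ ((2 * L).+1%:R ^+ d * (1 - 2 * r%:R / (2 * L).+1%:R) ^+ d)).
  rewrite ler_wpM2l ?exprn_ge0 ?ler0n// bernoulli_le//.
  by rewrite divr_ge0 ?mulr_ge0 ?ler0n//= ler_pdivrMr ?mul1r.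
rewrite -exprMn mulrBr mulr1 mulrCA divff ?gt_eqF// mulr1.
rewrite le_eqVlt; apply/orP; left; apply/eqP; congr (_ ^+ _).
rewrite -natrM -natrB; last lia.
by congr (_%:R); lia.
Qed.

Lemma box_average_ge (e : nat -> \bar R) (G s l : R) : 0 < G -> 0 <= s ->
  (forall L, 0 <= e L)%E ->
  (forall m, 0 < m -> m <= G -> exists r, forall L, (r <= L)%N ->
    ((s * ((G - m) / 2 * #|` box d (L - r)|%:R) - #|` box d L|%:R * l)%:E <= e L)%E) ->
  ((s * (G / 2) - l)%:E <= limn_einf (fun L => ((L%:R ^+ d)^-1)%:E * e L))%E.
Proof.
move=> G0 s0 e0 eP; apply/lee_addgt0Pr => eps eps0.
rewrite -leeBlDr// -EFinB; apply: limn_einf_ge.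
(* One half of [eps] pays for s m / 2, the other for the boundary layer of width r. The denominator
   [s + 1] covers the case s = 0. *)
pose m := Num.min G (eps / (s + 1)).
have s1 : 0 < s + 1 by lra.
have m0 : 0 < m by rewrite lt_min G0 divr_gt0.
have mG : m <= G by rewrite ge_min lexx.
have sm : s * m <= eps.
  have : m <= eps / (s + 1) by rewrite ge_min lexx orbT.
  by rewrite ler_pdivlMr//; nra.
have [r rP] := eP _ m0 mG.
pose A := s * ((G - m) / 2).
have A0 : 0 <= A by rewrite mulr_ge0// divr_ge0// subr_ge0.
have [N NP] : exists N, forall L, (N <= L)%N -> A * (d%:R * (2 * r%:R / (2 * L).+1%:R)) <= eps / 2.
  pose x := A * (d%:R * (2 * r%:R)) / (eps / 2).
  have x0 : 0 <= x.
    rewrite /x; apply: divr_ge0; last by apply: divr_ge0 => //; exact: ltW.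
    by apply: mulr_ge0 => //; rewrite !mulr_ge0.
  exists (Num.bound x) => L NL.
  have xL : x <= (2 * L).+1%:R.
    by rewrite ltW// (lt_le_trans (archi_boundP x0))// ler_nat; lia.
  rewrite !mulrA ler_pdivrMr ?ltr0n// -ler_pdivrMl ?divr_gt0//.
  by rewrite [leLHS](_ : _ = x)// /x [RHS]mulrC !mulrA.
near=> L.
have L0 : (0 < L)%N by near: L; exists 1%N.
have rL : (r <= L)%N by near: L; exists r.
have NL : (N <= L)%N by near: L; exists N.
set q := s * (G / 2) - l - eps.
have Ld : 0 < (L%:R ^+ d)^-1 :> R by rewrite invr_gt0 exprn_gt0 ?ltr0n.
(* A nonpositive target follows from [0 <= e L]; for a positive one, L^d <= (2 L + 1)^d works in the
   right direction. *)
have [q0|q0] := leP q 0.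
  by apply: (@le_trans _ _ 0%E); rewrite ?lee_fin// mule_ge0// lee_fin ltW.
apply: (@le_trans _ _ ((L%:R ^+ d)^-1%:E * (#|` box d L|%:R * q)%:E)%E).
  rewrite -EFinM lee_fin mulrA ler_peMl ?(ltW q0)// mulrC ler_pdivlMr ?exprn_gt0 ?ltr0n//.
  rewrite mul1r card_box natrX lerXn2r ?nnegrE// ler_nat; lia.
apply: lee_wpmul2l; first by rewrite lee_fin ltW.
apply: le_trans (rP L rL); rewrite lee_fin.
have := card_box_sub_ge rL; have := NP L NL.
have n0 : 0 <= #|` box d L|%:R :> R by [].
set dl := d%:R * _; set n := #|` box d L|%:R; set n' := #|` box d _|%:R => h1 h2.
have h3 : A * (n * (1 - dl)) <= A * n' by rewrite ler_wpM2l.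
have -> : s * ((G - m) / 2 * n') = A * n' by rewrite /A mulrA.
apply: le_trans (lerB h3 (lexx (n * l))).
have -> : A * (n * (1 - dl)) - n * l = n * (A - A * dl - l) by ring.
rewrite ler_wpM2l// /q; have : A = s * (G / 2) - s * m / 2 by rewrite /A; field.
lra.
Unshelve. all: by end_near. Qed.

End boxes.

Section test_functions.
Context {R : realType} {d : nat}.
Hypothesis d3 : (3 <= d)%N.
Notation g0 := (@green0 R d).

(** Switched off for centres outside the box of radius [L]. With [L - r] in place of [L], every test
    function then vanishes outside the full box, as [partition_function_ge] requires, and the
    centres lost form a layer of vanishing density. *)
Definition green_cutoff (m : R) (L : nat) (k i : site d) : R :=
  if k \in box d L then Num.max 0 (g0 (i - k) - m) else 0.

Lemma green_cutoff_outside m L r k i : (r <= L)%N ->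
  (forall x, m <= g0 x -> x \in box d r) ->
  i \notin box d L -> green_cutoff m (L - r) k i = 0.
Proof.
move=> rL rP iL; rewrite /green_cutoff; case: ifPn => // kL.
apply: max_l; rewrite subr_le0 leNgt; apply/negP => /ltW /rP ik.
move/negP: iL; apply; move: ik kL; rewrite !in_box => /forallP ik /forallP kL.
apply/forallP => j; have := ik j; have := kL j; rewrite !mxE.
by move: (i 0 j) (k 0 j) => x y; rewrite !ler_norml; lia.
Qed.

Lemma green_cutoff_ge0 m L k i : 0 <= green_cutoff m L k i.
Proof. by rewrite /green_cutoff; case: ifP => // _; rewrite le_max lexx. Qed.

(* Where the cutoff is positive it lies below the Green function by exactly m,
   and by at most m elsewhere, so there - laplacian is at most a delta. *)
Lemma denergy_green_cutoff_le m L r k : (r <= L)%N ->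
  (forall x, m <= g0 x -> x \in box d r) ->
  2^-1 * denergy id (box d L) (green_cutoff m (L - r) k) (green_cutoff m (L - r) k) <=
  2^-1 * green_cutoff m (L - r) k k.
Proof.
move=> rL rP; set T := green_cutoff m (L - r) k.
rewrite denergy_id_diag mulrA mulVf// mul1r energy_gaussian; last first.
  by move=> i; exact: green_cutoff_outside.
rewrite ler_wpM2l//.
apply: (@le_trans _ _ (\sum_(i <- box d L) T i * (i == k)%:R)); last first.
  have [kL|kL] := boolP (k \in box d L).
    rewrite (bigD1_seq k kL (fset_uniq _))/= eqxx mulr1 big1 ?addr0// => i ik.
    by rewrite (negbTE ik) mulr0.
  rewrite big1_seq ?green_cutoff_ge0// => i /andP[_ iL].
  have ik : i != k by apply: contraNneq kL => <-.
  by rewrite (negbTE ik) mulr0.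
apply: ler_sum => i _; have [Ti|Ti] := leP (T i) 0.
  have -> : T i = 0 by apply/le_anti; rewrite Ti green_cutoff_ge0.
  by rewrite !mul0r.
rewrite ler_pM2l//.
have kb : k \in box d (L - r).
  by move: Ti; rewrite /T /green_cutoff; case: ifP => //; rewrite ltxx.
have TE : T i = g0 (i - k) - m.
  move: Ti; rewrite /T /green_cutoff kb lt_max ltxx/= => Ti.
  by rewrite max_r// ltW.
have := @green0_laplacian R d d3 (i - k); rewrite -laplacian_shift subr_eq0 => <-.
rewrite lerN2 /laplacian ler_wpM2l ?ge0_inv4d//; apply: ler_sum => j _.
rewrite TE; have : g0 (j - k) - m <= T j by rewrite /T /green_cutoff kb le_max lexx orbT.
lra.
Qed.

Lemma green_cutoff_gain m L r : (r <= L)%N -> 0 <= m <= g0 0 ->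
  (forall x, m <= g0 x -> x \in box d r) ->
  let T := green_cutoff m (L - r) in
  (g0 0 - m) / 2 * #|` box d (L - r)|%:R <=
  \sum_(k <- box d L) (T k k - 2^-1 * denergy id (box d L) (T k) (T k)).
Proof.
move=> rL /andP[m0 mg] rP /=; set T := green_cutoff m (L - r).
apply: (@le_trans _ _ (\sum_(k <- box d L) T k k / 2)); last first.
  apply: ler_sum => k _; have := denergy_green_cutoff_le k rL rP; rewrite -/T; lra.
have Tkk k : T k k = if k \in box d (L - r) then g0 0 - m else 0.
  by rewrite /T /green_cutoff subrr max_r// subr_ge0.
have sub : {subset box d (L - r) <= box d L}.
  move=> k; rewrite !in_box => /forallP h; apply/forallP => j.
  by apply: le_trans (h j) _; rewrite lez_nat leq_subr.
rewrite (eq_bigr (fun k => if k \in box d (L - r) then (g0 0 - m) / 2 else 0)); last first.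
  by move=> k _; rewrite Tkk; case: ifP => // _; rewrite mul0r.
rewrite -big_mkcond/= -big_filter.
rewrite (perm_big (box d (L - r))); last first.
  apply: uniq_perm; rewrite ?filter_uniq ?fset_uniq// => k.
  by rewrite mem_filter; case: (boolP (k \in box d (L - r))) => // /sub ->.
by rewrite big_const_seq count_predT iter_addr_0 mulr_natr.
Qed.

End test_functions.

Theorem theorem1p3 (R : realType) (d : nat) (hd : (3 <= d)%N) (V : R -> R)
    (V_diff : forall t : R, derivable V t 1)
    (V_diff2 : forall t : R, derivable (derive1 V) t 1)
    (V_sup : forall t : R, derive1 (derive1 V) t <= 1)
    (V_growth :
       (1 < limf_einf (fun t : R => (ln (V t) / ln `|t|)%:E) (abs_infty R))%E) :
  exists G : site d -> site d -> R,
    unique is_inverse_neg_laplacian G /\ 0 < G 0 0 /\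
  exists B1 B2 : R, 0 < B1 /\ 0 < B2 /\
    forall (eps : {nonneg R}) (disp : measure_display)
      (Omega : measurableType disp) (P : probability Omega R)
      (eta : site d -> {RV P >-> R}),
    mutually_independent eta -> identically_distributed eta ->
    symmetrically_distributed eta ->
    ('E_P[fun w => (eta 0%R w ^+ 2)%R] < +oo)%E ->
    let term (L : nat) (i : site d) (w : Omega) : R :=
      eta i w * gibbs_mean V eps (box d L) (eta ^~ w) (fun phi => spin phi i) in
    let bound : \bar R :=
      ('E_P[fun w => (eta 0%R w ^+ 2)%R] * (G 0 0 / 2)%R%:E
       - (ln (B1 + B2 * eps%:num))%:E)%E in
    (* A single term may fail to have an expectation when V grows slower than
       quadratically; their sum always has one in ]-oo, +oo], and it is the sum
       of the expectations as soon as the negative parts are integrable. *)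
    (bound <= limn_einf (fun L =>
       ((L%:R ^+ d)^-1)%:E * 'E_P[fun w => (\sum_(i <- box d L) term L i w)%R]))%E /\
    ((forall L i, i \in box d L -> 'E_P[(term L i)^\-] < +oo)%E ->
     (bound <= limn_einf (fun L =>
       ((L%:R ^+ d)^-1)%:E * \sum_(i <- box d L) 'E_P[term L i]))%E).
Proof.
have d0 : (0 < d)%N by exact: leq_trans hd.
have cV : continuous V by exact: derivable_continuous.
have grow := superlinear_growth cV V_growth.
exists (@green R d); split.
  by split; [exact: green_inverse|move=> G; exact: green_unique].
pose g0 := @green0 R d; have G00 : @green R d 0 0 = g0 0.
  by rewrite /green subrr.
have Gpos := @green0_gt0 R d hd.
rewrite G00; split => //.
have [B1 [B2 [B10 [B20 BP]]]] := gibbs_mean_ge d0 V_diff V_diff2 V_sup grow.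
exists B1, B2; split => //; split => // eps disp Omega P eta indep ident symm eta2.
move=> term bound.
pose mu L w i := gibbs_mean V eps (box d L) (eta ^~ w) (fun phi => spin phi i).
have mterm L i : measurable_fun setT (term L i).
  apply: measurable_funM => //.
  exact: (measurable_gibbs_mean_spin d0 V_diff V_diff2 V_sup grow (eta := fun w => eta ^~ w)).
have msum L : measurable_fun setT (fun w => \sum_(i <- box d L) term L i w).
  by apply: measurable_sum => i; exact: mterm.
(* The means [mu0] at zero field are deterministic, so the minorant is an instance of
   [integral_field_quadratic] with only a linear part; this also gives its integrability. *)
have low0 L : (0 <= \int[P]_w (\sum_(i <- box d L) term L i w)%:E)%E.
  pose mu0 i := gibbs_mean V eps (box d L) (fun=> 0) (fun phi => spin phi i).
  have [iY EY] := @integral_field_quadratic R disp Omega P _ eta 0 indep ident symm eta2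
    (box d L) (fun _ _ => 0) mu0 0 (fset_uniq _).
  rewrite big1 ?mulr0 ?subr0 in EY => //; rewrite -[leLHS]/(0%:E) -EY.
  apply: le_integral_integrablel => // w.
  rewrite subr0 big1 ?add0r; last by move=> k _; rewrite big1// => l _; rewrite mulr0.
  exact: (gibbs_mean_monotone d0 V_diff V_diff2 V_sup grow (eps := eps) (mu0 := mu0) (mu := mu L w)).
pose s := field_variance eta 0.
pose l := ln (B1 + B2 * eps%:num).
have lowm m : 0 < m -> m <= g0 0 -> exists r, forall L, (r <= L)%N ->
    ((s * ((g0 0 - m) / 2 * #|` box d (L - r)|%:R) - #|` box d L|%:R * l)%:E <=
     \int[P]_w (\sum_(i <- box d L) term L i w)%:E)%E.
  (* The range [r] is the radius of a superlevel set of the Green function. It depends on [m] but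
     not on [L], which makes the boundary layer negligible. *)
  move=> m0 mG; have [r rP] := finite_set_in_box (@green0_vanishes R d hd _ m0).
  have rP' x : m <= g0 x -> x \in box d r.
    by move=> mx; apply: rP; rewrite /= (le_trans mx)// ler_norm.
  exists r => L rL; pose T := @green_cutoff R d m (L - r).
  have T0 k i : i \notin box d L -> T k i = 0 by exact: green_cutoff_outside.
  have [b bP] := BP eps (box d L) T T0.
  have [iY EY] := @integral_field_quadratic R disp Omega P _ eta 0 indep ident symm eta2
    (box d L) (fun k l => T l k - 2^-1 * denergy id (box d L) (T k) (T l)) b
    (#|` box d L|%:R * l) (fset_uniq _).
  apply: (@le_trans _ _ (s * (\sum_(k <- box d L)
      (T k k - 2^-1 * denergy id (box d L) (T k) (T k))) - #|` box d L|%:R * l)%:E).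
    rewrite lee_fin lerB// ler_wpM2l ?field_variance_ge0//.
    by apply: (green_cutoff_gain hd rL _ rP'); rewrite (ltW m0).
  rewrite -EY; apply: le_integral_integrablel => // w.
  exact: (bP (eta ^~ w) (mu L w)).
have boundE : bound = (s * (g0 0 / 2) - l)%:E.
  by rewrite /bound (field_varianceE eta2) EFinB EFinM.
(* Both conclusions concern a sequence that dominates the expectation of the sum: it is equal to it
   in the first, and above it by [integral_sum_le] in the second. *)
have sum_low (e : nat -> \bar R) :
    (forall L, \int[P]_w (\sum_(i <- box d L) term L i w)%:E <= e L)%E ->
    (bound <= limn_einf (fun L => ((L%:R ^+ d)^-1)%:E * e L))%E.
  move=> he; rewrite boundE; apply: box_average_ge => //.
  - exact: field_variance_ge0.
  - by move=> L; exact: le_trans (low0 L) (he L).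
  - move=> m m0 mG; have [r rP] := lowm m m0 mG.
    by exists r => L rL; exact: le_trans (rP L rL) (he L).
split; first by apply: sum_low => L; rewrite expectation.unlock.
move=> negfin; apply: sum_low => L; rewrite expectation.unlock.
apply: integral_sum_le => // i iL.
(* The hypothesis speaks of the negative part of a real function, the goal of that of its
   extended-real version. *)
have := negfin L i iL; rewrite expectation.unlock; congr (_ < _)%E.
by apply: eq_integral => w _; rewrite funenegE /funrneg/= EFin_max.
Qed.
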